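(* Let $X$ be a unital uniform algebra. If $(\partial X)'$ is an infinite set, then $X$ has the weak-DD2P.
   Context: A unital uniform algebra is a closed subalgebra $X$ of $C(K)$, where $K$ is a compact Hausdorff space and $C(K)$ is the Banach algebra of continuous scalar-valued functions on $K$ with the supremum norm, such that $X$ separates the points of $K$ and contains the constant functions. The Choquet boundary of $X$ is $\partial X=\{s\in K:\ \delta_s|_X\in\operatorname{ext}(B_{X^*})\}$, where $\delta_s(f)=f(s)$ and $\operatorname{ext}(B_{X^*})$ is the set of extreme points of the closed unit ball of the dual; it is endowed with the topology induced from $K$. $(\partial X)'$ denotes the set of cluster (accumulation) points of the topological space $\partial X$ (so $(\partial X)'\subseteq\partial X$). A Banach space $X$ has the weak-DD2P if for every non-empty relatively weakly open subset $W$ of the closed unit ball $B_X$ there exists $x\in W$ such that $\sup_{y\in V}\|x-y\|=2$ for every relatively weakly open subset $V$ of $B_X$ with $x\in V$. *)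

(* Defs.v *)
From HB Require Import structures.
From mathcomp Require Import all_boot all_order all_algebra.
From mathcomp Require Import all_classical all_reals topology normedtype.
From mathcomp Require Import complex.

Set Implicit Arguments.
Unset Strict Implicit.
Unset Printing Implicit Defensive.

Import Order.TTheory GRing.Theory Num.Theory.
Import numFieldNormedType.Exports.

Local Open Scope classical_set_scope.
Local Open Scope ring_scope.

(* The scalar field is either R or R[i], for R an arbitrary model of the real
   numbers.  The norm of a normed module over R[i] takes its values in R[i],
   whose (partial) order extends that of R: z <= w means that w - z is a
   nonnegative real. *)
Variant scalar_kind := RealScalars | ComplexScalars.

Definition scalars (R : realType) (k : scalar_kind) : numFieldType :=
  match k with
  | RealScalars => R
  | ComplexScalars => R[i]
  end.

Section scalars_lemmas.
Variables (R : realType) (k : scalar_kind).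

Lemma scalars_archi (z : scalars R k) : exists n : nat, `|z| < n%:R.
Proof.
case: k z => /= z.
  by exists (Num.truncn `|z|).+1; exact: truncnS_gt.
have z0 := normr_ge0 z.
have [n] : exists n : nat, complex.Re `|z| < n%:R.
  by exists (Num.truncn (complex.Re `|z|)).+1; exact: truncnS_gt.
move=> zn; exists n.
move: z0 zn; case: (`|z|) => a b; rewrite lecE/= => /andP[/eqP -> a0] an.
by rewrite -(rmorph_nat (real_complex R)) ltcE/= eqxx.
Qed.

Lemma scalars_sup (A : set (scalars R k)) : A !=set0 ->
  A `<=` [set z | 0 <= z] -> has_ubound A -> supremums A !=set0.
Proof.
case: k A => /= A A0 Age0 Aub.
  by exists (sup A); split; [exact: ub_le_sup|move=> y; exact: ge_sup].
pose B := [set complex.Re z | z in A].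
have AE z : A z -> z = (complex.Re z)%:C%C.
  by move=> /Age0; case: z => a b /=; rewrite lecE/= => /andP[/eqP ->].
have hB : has_sup B.
  split; first by case: A0 => z Az; exists (complex.Re z), z.
  case: Aub => -[u v] Au; exists u => _ [z /Au + <-].
  by case: z => a b; rewrite lecE/= => /andP[].
exists ((sup B)%:C)%C; split.
  move=> z Az; rewrite (AE _ Az) lecR.
  by apply: ub_le_sup; [case: hB|exists z].
move=> [u v] Au; have [z Az] := A0.
have := Au _ Az; rewrite (AE _ Az) !lecE/= => /andP[-> _] /=.
apply: ge_sup; first by case: hB.
by move=> _ [w /Au + <-]; case: w => a b; rewrite lecE/= => /andP[].
Qed.

End scalars_lemmas.

HB.mixin Record isCompactHausdorff K & Topological K := {
  compact_setT : compact [set: K];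
  hausdorff : hausdorff_space K
}.

#[short(type="compactHausdorffType")]
HB.structure Definition CompactHausdorff :=
  {K of Topological K & isCompactHausdorff K}.

(* C(K) with pointwise operations and the supremum norm; K may be empty, so
   that C(K) need not be a nontrivial ring. *)
Section cfun.
Variables (K : compactHausdorffType) (R : realType) (k : scalar_kind).
Let F : numFieldType := scalars R k.

Definition cfun : Type := continuousType K F.

HB.instance Definition _ := Choice.copy cfun (continuousType K F).

Definition cfun_pred : {pred K -> F} := [pred f | `[< continuous f >]].

Definition cfun_val (f : cfun) : K -> F := @Continuous.sort K F f.
Coercion cfun_val : cfun >-> Funclass.

Definition cfun_Sub (f : K -> F) (cf : f \in cfun_pred) : cfun :=
  (mkcts (asboolW cf) : continuousType K F).

Lemma cfun_rect (P : cfun -> Type) :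
  (forall f (cf : f \in cfun_pred), P (cfun_Sub cf)) -> forall f, P f.
Proof.
move=> PS f.
have cf : (f : K -> F) \in cfun_pred by apply/asboolP; exact: (@cts_fun K F f).
suff -> : f = cfun_Sub cf by [].
by apply/continuousEP.
Qed.

Lemma cfun_SubK (f : K -> F) (cf : f \in cfun_pred) : cfun_Sub cf = f :> (K -> F).
Proof. by []. Qed.

HB.instance Definition _ := @isSub.Build (K -> F) cfun_pred cfun
  cfun_val cfun_Sub cfun_rect cfun_SubK.

Lemma cfun_subring_closed : subring_closed cfun_pred.
Proof.
split=> [|f g /asboolP cf /asboolP cg|f g /asboolP cf /asboolP cg];
  apply/asboolP => x.
- exact: cvg_cst.
- by apply: cvgB; [exact: cf|exact: cg].
- by apply: cvgM; [exact: cf|exact: cg].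
Qed.

HB.instance Definition _ :=
  GRing.SubChoice_isSubComPzRing.Build (K -> F) cfun_pred cfun
    cfun_subring_closed.

Lemma cfun_subsemimod_closed : GRing.subsemimod_closed cfun_pred.
Proof.
split.
  split=> [|f g /asboolP cf /asboolP cg]; apply/asboolP => x.
    exact: cvg_cst.
  by apply: cvgD; [exact: cf|exact: cg].
move=> c f /asboolP cf; apply/asboolP => x.
by apply: cvgM; [exact: cvg_cst|exact: cf].
Qed.

HB.instance Definition _ :=
  GRing.SubZmodule_isSubLmodule.Build F (K -> F) cfun_pred cfun
    cfun_subsemimod_closed.

(* Supremum of the moduli of the values (0 if K is empty) *)
Definition cfun_norm (f : cfun) : F :=
  supremum 0 (range (fun s => `|f s|)).

Lemma cfun_has_ubound (f : cfun) : has_ubound (range (fun s => `|f s|)).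
Proof.
have /compact_near_coveringP := @compact_setT K.
move=> /(_ nat \oo (fun n s => `|f s| <= n%:R)) [].
  move=> s _; have [n fn] := scalars_archi (f s).
  have ffn : \forall t \near s, `|f t| < n%:R.
    by apply: cvgr_norm_lt fn; exact: (@cts_fun K F f).
  exists ([set t | `|f t| < n%:R], [set m | (n <= m)%N]) => /=.
    by split=> //; exists n.
  by move=> [t m] /= [/ltW ft nm]; rewrite (le_trans ft)// ler_nat.
move=> n _ /(_ n (leqnn n)) fn.
by exists n%:R => _ [s _ <-]; exact: fn.
Qed.

Lemma cfun_norm_sup (f : cfun) (s : K) :
  supremums (range (fun s => `|f s|)) (cfun_norm f).
Proof.
rewrite /cfun_norm /supremum; case: ifPn => [/eqP A0|_].
  have : range (fun s => `|f s|) `|f s| by exists s.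
  by rewrite A0.
have [] // := @scalars_sup R k (range (fun s => `|f s|)).
- by exists `|f s|, s.
- by move=> _ [t _ <-] /=.
- exact: cfun_has_ubound.
by move=> x Ax; case: xgetP => // /(_ x).
Qed.

Lemma cfun_norm_ge (f : cfun) (s : K) : `|f s| <= cfun_norm f.
Proof. by have [+ _] := cfun_norm_sup f s; apply; exists s. Qed.

Lemma cfun_norm_le (f : cfun) (M : F) : 0 <= M ->
  (forall s, `|f s| <= M) -> cfun_norm f <= M.
Proof.
move=> M0 fM; have [s|K0] := pselect (exists s : K, True).
  case: s => s _; have [_] := cfun_norm_sup f s; apply.
  by move=> _ [t _ <-].
have -> // : cfun_norm f = 0; rewrite /cfun_norm.
have -> : range (fun s => `|f s|) = set0; last exact: supremum0.
by apply/seteqP; split=> // t [s _ _]; case: K0; exists s.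
Qed.

Lemma cfun_norm_ge0 (f : cfun) : 0 <= cfun_norm f.
Proof.
have [[s _]|K0] := pselect (exists s : K, True).
  exact: le_trans (cfun_norm_ge f s).
have -> // : cfun_norm f = 0; rewrite /cfun_norm.
have -> : range (fun s => `|f s|) = set0; last exact: supremum0.
by apply/seteqP; split=> // t [s _ _]; case: K0; exists s.
Qed.

Lemma cfun_normD (f g : cfun) : cfun_norm (f + g) <= cfun_norm f + cfun_norm g.
Proof.
apply: cfun_norm_le => [|s]; first by rewrite addr_ge0 ?cfun_norm_ge0.
by rewrite (le_trans (ler_normD _ _))// lerD ?cfun_norm_ge.
Qed.

Lemma cfun_normZ (c : F) (f : cfun) : cfun_norm (c *: f) = `|c| * cfun_norm f.
Proof.
have H (a : F) (g : cfun) : cfun_norm (a *: g) <= `|a| * cfun_norm g.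
  apply: cfun_norm_le => [|s]; first by rewrite mulr_ge0 ?cfun_norm_ge0.
  by rewrite [leLHS]normrM ler_wpM2l ?cfun_norm_ge.
apply/eqP; rewrite eq_le H /=; have [->|c0] := eqVneq c 0.
  by rewrite normr0 mul0r cfun_norm_ge0.
rewrite -ler_pdivlMl ?normr_gt0// -normfV.
by have := H c^-1 (c *: f); rewrite scalerA mulVf// scale1r.
Qed.

Lemma cfun_norm0_eq0 (f : cfun) : cfun_norm f = 0 -> f = 0.
Proof.
move=> f0; apply/continuousEP => s /=; apply/eqP.
by rewrite -normr_le0 -f0; exact: cfun_norm_ge.
Qed.

HB.instance Definition _ := Lmodule_isNormed.Build F cfun
  cfun_normD cfun_normZ cfun_norm0_eq0.

End cfun.

(* [closed] refers to the supremum-norm topology of C(K). *)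
Record uniform_algebra (K : compactHausdorffType) (R : realType)
    (k : scalar_kind) := UniformAlgebra {
  ua_set : set (cfun K R k);
  ua_closed : closed ua_set;
  ua_add : forall f g, ua_set f -> ua_set g -> ua_set (f + g);
  ua_scale : forall c f, ua_set f -> ua_set (c *: f);
  ua_mul : forall f g, ua_set f -> ua_set g -> ua_set (f * g);
  ua_cst : forall c : scalars R k,
    ua_set (cst c : continuousType K (scalars R k));
  ua_separates : forall s t : K, s <> t ->
    exists2 f, ua_set f & f s <> f t
}.

(* The elements of X, as a normed space under the norm inherited from C(K);
   the dual of X and its weak topology are those of this space. *)
Section ua_type.
Variables (K : compactHausdorffType) (R : realType) (k : scalar_kind).
Variable X : uniform_algebra K R k.
Let F : numFieldType := scalars R k.

Definition ua_pred : {pred cfun K R k} := [pred f | f \in ua_set X].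

Record ua_type := UAType { ua_val :> cfun K R k ; _ : ua_val \in ua_pred }.

HB.instance Definition _ := [isSub for ua_val].
HB.instance Definition _ := [Choice of ua_type by <:].

Lemma ua_subsemimod_closed : GRing.subsemimod_closed ua_pred.
Proof.
split.
  split=> [|f g]; rewrite !inE; last exact: ua_add.
  by have := @ua_scale K R k X 0 _ (ua_cst X 0); rewrite scale0r.
by move=> c f; rewrite !inE; exact: ua_scale.
Qed.

HB.instance Definition _ :=
  GRing.SubChoice_isSubLmodule.Build F (cfun K R k) ua_pred ua_type
    ua_subsemimod_closed.

Lemma ua_normD (f g : ua_type) :
  `|ua_val (f + g)| <= `|ua_val f| + `|ua_val g|.
Proof. exact: ler_normD. Qed.

Lemma ua_normZ (c : F) (f : ua_type) : `|ua_val (c *: f)| = `|c| * `|ua_val f|.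
Proof. exact: normrZ. Qed.

Lemma ua_norm0_eq0 (f : ua_type) : `|ua_val f| = 0 -> f = 0.
Proof. by move=> /normr0_eq0 f0; exact: val_inj. Qed.

HB.instance Definition _ := Lmodule_isNormed.Build F ua_type
  ua_normD ua_normZ ua_norm0_eq0.

End ua_type.

Section normed_space.
Variables (F : numFieldType) (E : normedModType F).

Definition unit_ball : set E := [set x | `|x| <= 1].

Definition topological_dual : set (E -> F) :=
  [set phi | linear phi /\ continuous phi].

(* The operator norm of phi is the supremum of |phi x| for x in the unit ball *)
Definition dual_unit_ball : set (E -> F) :=
  [set phi | topological_dual phi /\ forall x, unit_ball x -> `|phi x| <= 1].

(* The coarsest topology making every element of the dual continuous *)
Definition weak_topology : Type :=
  sup_topology (fun phi : {phi : E -> F | topological_dual phi} =>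
    Topological.on (initial_topology (sval phi))).

HB.instance Definition _ := Topological.on weak_topology.

Definition relatively_weakly_open (W : set E) :=
  exists2 U : set weak_topology, open U & W = unit_ball `&` U.

Definition weak_DD2P :=
  forall W : set E, relatively_weakly_open W -> W !=set0 ->
    exists2 x, W x &
      forall V : set E, relatively_weakly_open V -> V x ->
        supremums [set `|x - y| | y in V] 2%:R.

End normed_space.

Definition extreme_points (F : numFieldType) (V : lmodType F) (C : set V) :
    set V :=
  [set x | C x /\ forall (y z : V) (t : F), C y -> C z -> 0 < t < 1 ->
    x = t *: y + (1 - t) *: z -> y = x /\ z = x].

Definition choquet_boundary (K : compactHausdorffType) (R : realType)
    (k : scalar_kind) (X : uniform_algebra K R k) : set K :=
  [set s | extreme_points (dual_unit_ball (E := ua_type X))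
             (fun f : ua_type X => f s)].

(* Cluster points of A as a topological space in its own right: the limit
   points of A that belong to A *)
Definition derived_set (T : topologicalType) (A : set T) : set T :=
  A `&` limit_point A.

(* Main.v *)
Require Import Defs.
From mathcomp Require Import all_boot all_order all_algebra.
From mathcomp Require Import all_classical all_reals topology normedtype.
From HB Require Import structures.
From mathcomp Require Import sequences complex ring lra.

(** The engine is a deformation of functions at Choquet boundary points.  Let v
    lie in the unit ball of X, let s be in the Choquet boundary and let U be an
    open neighbourhood of s.  Then some y in the unit ball takes the value 1 at s
    and is uniformly as close as desired to v off U ([peak_perturbation]).
    Do this at points s_n with pairwise disjoint neighbourhoods U_n, with errors
    2^-n: the sums of |y_n - v| are then uniformly bounded on K, since at each
    point at most one term is large.  So the sums of |phi(y_n - v)| are bounded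
    for every phi in the dual, and y_n tends to v weakly
    ([weak_approx_peaking]).

    This is used twice.  The infinite set of cluster points of the boundary
    contains points s_n with disjoint neighbourhoods, so a non-empty weakly open
    subset W of the ball contains some x with x(s) = 1 at a cluster point s.
    Given a weak neighbourhood V of x, the boundary has points s'_n with disjoint
    neighbourhoods near s, where x is almost 1; applied to -x, the engine gives
    functions y_n of the ball tending to -x weakly with y_n(s'_n) = 1.
    Eventually -y_n is in V, while |x + y_n| is almost 2 at s'_n
    ([derived_point_DD2P]).

    The deformation combines v with a function h of the ball of X that equals 1
    at s and is small off U ([peak]).  In the half plane of the Cayley transform
    p = (1 + x) / (1 - x), the functions of modulus at most 1 become those with
    non-negative real part, which may be added.  Take w = (1 - e/2) v; adding to
    the transform of w a small positive multiple of the transform of h and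
    transforming back gives an explicit quotient of elements of X, which is
    bounded by 1, equals 1 at s, and is close to w where h is small.

    The peak function comes from the extremality of evaluation at s.  By
    Hahn-Banach there is a positive functional L on the real continuous functions,
    equal to Re f(s) at Re f for f in X, and whose value at a given g is the
    infimum of Re q(s) over the q in X with Re q >= g.  Splitting L into its
    products with 1 + u and 1 - u writes evaluation at s as a convex combination
    in the dual ball, so extremality gives L(u Re f) = 0 whenever f(s) = 0.  With
    u = Re f, the infimum attached to g = (Re f)^2 vanishes
    ([choquet_sqr_majorant]).  By compactness some q in X has Re q >= 4 off U,
    Re q >= 0, and Re q(s) as small as desired; once q(s) is made real by a
    constant, (1 + q(s)) / (1 + q) almost peaks at s ([approx_peak]).  A series
    of such functions, each adapted to the partial sum before it, peaks
    exactly. *)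

Set Implicit Arguments.
Unset Strict Implicit.
Unset Printing Implicit Defensive.

Import Order.TTheory GRing.Theory Num.Theory.
Import numFieldNormedType.Exports.

Local Open Scope classical_set_scope.
Local Open Scope ring_scope.

(** * Real parts, imaginary parts and moduli of the scalars *)

Section scalars_theory.
Variables (R : realType) (k : scalar_kind).
Local Notation F := (scalars R k).

(** Re, Im, the reconstruction [mk] and the real-valued modulus [nrm] treat real
    and complex scalars alike (with Im = 0 for real scalars), and move estimates
    into the ordered field R. *)
Definition re : F -> R :=
  match k return scalars R k -> R with
  | RealScalars => id
  | ComplexScalars => @complex.Re R
  end.

Definition im : F -> R :=
  match k return scalars R k -> R with
  | RealScalars => fun=> 0
  | ComplexScalars => @complex.Im R
  end.

Definition mk (a b : R) : F :=
  match k return scalars R k with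
  | RealScalars => a
  | ComplexScalars => Complex a b
  end.

Definition rc (a : R) : F := mk a 0.
Definition nrm (z : F) : R := re `|z|.

Lemma mkE z : mk (re z) (im z) = z.
Proof. by rewrite /mk /re /im; case: k z => //= -[]. Qed.

Lemma re_mk a b : re (mk a b) = a.
Proof. by rewrite /mk /re /im; case: k. Qed.

Lemma re_rc a : re (rc a) = a. Proof. exact: re_mk. Qed.
Lemma im_rc a : im (rc a) = 0.
Proof. by rewrite /rc /mk /re /im; case: k. Qed.

Lemma reD z w : re (z + w) = re z + re w.
Proof. by rewrite /re; case: k z w => //= -[a b] [c d]. Qed.
Lemma imD z w : im (z + w) = im z + im w.
Proof. rewrite /im; case: k z w => /=; [by rewrite addr0|by move=> [a b] [c d]]. Qed.
Lemma reN z : re (- z) = - re z.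
Proof. by rewrite /re; case: k z => //= -[a b]. Qed.
Lemma imN z : im (- z) = - im z.
Proof. rewrite /im; case: k z => /=; [by rewrite oppr0|by move=> [a b]]. Qed.
Lemma reB z w : re (z - w) = re z - re w.
Proof. by rewrite reD reN. Qed.
Lemma imB z w : im (z - w) = im z - im w.
Proof. by rewrite imD imN. Qed.
Lemma reM z w : re (z * w) = re z * re w - im z * im w.
Proof.
rewrite /re /im; case: k z w => /= [z w|[a b] [c d]//].
by rewrite mul0r subr0.
Qed.
Lemma imM z w : im (z * w) = re z * im w + im z * re w.
Proof.
rewrite /re /im; case: k z w => /= [z w|[a b] [c d]//].
by rewrite mul0r mulr0 addr0.
Qed.

Lemma mkD a b c d : mk (a + c) (b + d) = mk a b + mk c d.
Proof. by rewrite /mk; case: k. Qed.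
Lemma mulmk z a b : z * mk a b = mk (re z * a - im z * b) (re z * b + im z * a).
Proof.
by rewrite /mk /re /im; case: k z => /= [z|[c d]//]; rewrite mul0r subr0.
Qed.

Lemma rc0 : rc 0 = 0. Proof. by rewrite /rc /mk; case: k. Qed.
Lemma rc1 : rc 1 = 1. Proof. by rewrite /rc /mk; case: k. Qed.
Lemma re1 : re 1 = 1. Proof. by rewrite -rc1 re_rc. Qed.
Lemma im1 : im 1 = 0. Proof. by rewrite -rc1 im_rc. Qed.
Lemma re0 : re 0 = 0. Proof. by rewrite -rc0 re_rc. Qed.
Lemma rcD a b : rc (a + b) = rc a + rc b.
Proof. by rewrite /rc -mkD addr0. Qed.
Lemma rcM a b : rc (a * b) = rc a * rc b.
Proof. by rewrite {3}/rc mulmk re_rc im_rc !mul0r subr0 mulr0 addr0. Qed.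
Lemma rcN a : rc (- a) = - rc a.
Proof. by rewrite -[RHS]mkE reN imN re_rc im_rc oppr0. Qed.
Lemma rcB a b : rc (a - b) = rc a - rc b.
Proof. by rewrite rcD rcN. Qed.
Lemma ler_rc a b : (rc a <= rc b) = (a <= b).
Proof. by rewrite /rc /mk; case: k => //=; rewrite lecE/= eqxx. Qed.
Lemma ltr_rc a b : (rc a < rc b) = (a < b).
Proof. by rewrite /rc /mk; case: k => //=; rewrite ltcE/= eqxx. Qed.
Lemma rc_nat n : rc n%:R = n%:R.
Proof. by elim: n => [|n IH]; rewrite ?rc0// -natr1 rcD IH rc1 natr1. Qed.
Lemma rcV a : rc a^-1 = (rc a)^-1.
Proof.
have [->|a0] := eqVneq a 0; first by rewrite !(invr0, rc0).
have ra0 : rc a != 0.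
  by apply: contra_neq a0 => /(congr1 re); rewrite re_rc re0.
by apply: (mulfI ra0); rewrite -rcM !mulfV// rc1.
Qed.

Lemma ge0_rc z : 0 <= z -> z = rc (re z).
Proof.
rewrite /rc /mk /re; case: k z => //= -[a b].
by rewrite lecE/= => /andP[/eqP ->].
Qed.

Lemma normE z : `|z| = rc (nrm z).
Proof. exact: ge0_rc. Qed.

Lemma nrm_ge0 z : 0 <= nrm z.
Proof. by rewrite -ler_rc -normE rc0. Qed.
Lemma nrm_sqr z : nrm z ^+ 2 = re z ^+ 2 + im z ^+ 2.
Proof.
rewrite /nrm /re /im; case: k z => /= [z|[a b]].
  by rewrite expr0n/= addr0 real_normK// num_real.
by rewrite sqr_sqrtr// addr_ge0 ?sqr_ge0.
Qed.
Lemma nrmM z w : nrm (z * w) = nrm z * nrm w.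
Proof. by rewrite {1}/nrm normrM !normE -rcM re_rc. Qed.
Lemma nrmD z w : nrm (z + w) <= nrm z + nrm w.
Proof. by rewrite -ler_rc rcD -!normE ler_normD. Qed.
Lemma nrmN z : nrm (- z) = nrm z.
Proof. by rewrite /nrm normrN. Qed.
Lemma nrmB z w : nrm (z - w) <= nrm z + nrm w.
Proof. by rewrite -(nrmN w) nrmD. Qed.
Lemma nrmBC z w : nrm (z - w) = nrm (w - z).
Proof. by rewrite -nrmN opprB. Qed.
Lemma nrm_rc a : nrm (rc a) = `|a|.
Proof.
apply: (@pexpIrn _ 2); rewrite ?nnegrE ?nrm_ge0//.
by rewrite nrm_sqr re_rc im_rc expr0n/= addr0 real_normK// num_real.
Qed.
Lemma nrm0 : nrm 0 = 0. Proof. by rewrite -rc0 nrm_rc normr0. Qed.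
Lemma nrm1 : nrm 1 = 1. Proof. by rewrite -rc1 nrm_rc normr1. Qed.
Lemma nrmX z n : nrm (z ^+ n) = nrm z ^+ n.
Proof. by elim: n => [|n IH]; rewrite ?nrm1// !exprS nrmM IH. Qed.
Lemma nrmV z : nrm z^-1 = (nrm z)^-1.
Proof. by rewrite {1}/nrm normfV normE -rcV re_rc. Qed.
Lemma nrm_eq0 z : (nrm z == 0) = (z == 0).
Proof.
apply/eqP/eqP => [z0|->]; last exact: nrm0.
by apply/eqP; rewrite -normr_eq0 normE z0 rc0.
Qed.
Lemma nrm_gt0 z : (0 < nrm z) = (z != 0).
Proof. by rewrite lt_def nrm_ge0 andbT nrm_eq0. Qed.
Lemma re_le_nrm z : `|re z| <= nrm z.
Proof.
rewrite -(@ler_pXn2r _ 2)// ?nnegrE ?nrm_ge0// nrm_sqr real_normK ?num_real//.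
by rewrite lerDl sqr_ge0.
Qed.
Lemma im_le_nrm z : `|im z| <= nrm z.
Proof.
rewrite -(@ler_pXn2r _ 2)// ?nnegrE ?nrm_ge0// nrm_sqr real_normK ?num_real//.
by rewrite lerDr sqr_ge0.
Qed.
Lemma nrm_mk a b : nrm (mk a b) <= `|a| + `|b|.
Proof.
rewrite /nrm /mk /re; case: k => /=; first by rewrite lerDl.
rewrite -(@ler_pXn2r _ 2)// ?nnegrE ?sqrtr_ge0// ?addr_ge0//.
rewrite sqr_sqrtr ?addr_ge0 ?sqr_ge0// sqrrD !real_normK ?num_real//.
by rewrite addrAC lerDl mulrn_wge0// mulr_ge0.
Qed.

(** Rotating a scalar onto its modulus reduces bounds on |phi(f)|, for a linear
    phi, to bounds on real parts. *)
Lemma nrm_rot z : exists2 l, nrm l = 1 & l * z = rc (nrm z).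
Proof.
have [->|z0] := eqVneq z 0.
  by exists 1; rewrite ?nrm1// mulr0 nrm0 rc0.
have nz : nrm z != 0 by rewrite nrm_eq0.
exists (rc (nrm z) / z); last by rewrite mulfVK.
by rewrite nrmM nrmV nrm_rc ger0_norm ?nrm_ge0// mulfV.
Qed.

Lemma re_continuous : continuous re.
Proof.
move=> z; apply/(@cvgrPdist_lt _ _ _ (nbhs z)) => e e0.
have e0' : 0 < rc e by rewrite -rc0 ltr_rc.
near=> w.
rewrite -reB; apply: le_lt_trans (re_le_nrm _) _.
rewrite -ltr_rc -normE; near: w.
by apply/nbhs_normP; exists (rc e).
Unshelve. all: by end_near. Qed.

Lemma im_continuous : continuous im.
Proof.
move=> z; apply/(@cvgrPdist_lt _ _ _ (nbhs z)) => e e0.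
have e0' : 0 < rc e by rewrite -rc0 ltr_rc.
near=> w.
rewrite -imB; apply: le_lt_trans (im_le_nrm _) _.
rewrite -ltr_rc -normE; near: w.
by apply/nbhs_normP; exists (rc e).
Unshelve. all: by end_near. Qed.

Lemma nrm_continuous : continuous nrm.
Proof.
move=> z; apply: (@continuous_comp _ _ _ (fun z : F => `|z|) re).
  exact: norm_continuous.
exact: re_continuous.
Qed.

End scalars_theory.

(** * The Hahn-Banach theorem through minimal sublinear functionals *)

Section hahn_banach.
Variables (R : realType) (V : lmodType R).

Definition sublinear (p : V -> R) :=
  (forall x y, p (x + y) <= p x + p y) /\
  (forall t x, 0 <= t -> p (t *: x) <= t * p x).

Lemma sublinear_ge0 p : sublinear p -> 0 <= p 0.
Proof. by move=> [/(_ 0 0) pD _]; move: pD; rewrite addr0 lerDl. Qed.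

Lemma sublinear_ge p x : sublinear p -> - p (- x) <= p x.
Proof.
move=> sp; have p0 := sublinear_ge0 sp; case: sp => /(_ x (- x)) + _.
by rewrite subrr; lra.
Qed.

(** The sublinear functionals constructed below are infima of sets of reals that
    are compatible, up to smaller elements, with sums and non-negative
    multiples. *)
Lemma sublinear_inf (S : V -> set R) :
  (forall x, S x !=set0) -> (forall x, has_lbound (S x)) ->
  (forall x y a b, S x a -> S y b -> exists2 c, S (x + y) c & c <= a + b) ->
  (forall t x a, 0 <= t -> S x a -> exists2 c, S (t *: x) c & c <= t * a) ->
  sublinear (fun x => inf (S x)).
Proof.
move=> S0 lS SD SZ; split=> [x y|t x].
  rewrite -lerBlDr; apply: lb_le_inf => // a Sa.
  rewrite lerBlDr -lerBlDl; apply: lb_le_inf => // b Sb.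
  have [c Sc cab] := SD _ _ _ _ Sa Sb.
  rewrite lerBlDl (le_trans _ cab)//; exact: ge_inf.
rewrite le_eqVlt => /predU1P[<-|t0].
  have [a Sa] := S0 x; have [c Sc] := SZ 0 x a (lexx _) Sa.
  by rewrite !mul0r => c0; rewrite (le_trans _ c0)//; exact: ge_inf.
rewrite mulrC -ler_pdivrMr//; apply: lb_le_inf => // a Sa.
have [c Sc cta] := SZ t x a (ltW t0) Sa.
rewrite ler_pdivrMr// mulrC (le_trans _ cta)//; exact: ge_inf.
Qed.

Lemma sublinear0 p : sublinear p -> p 0 = 0.
Proof.
move=> sp; apply/eqP; rewrite eq_le sublinear_ge0// andbT.
by have [_ /(_ 0 0 (lexx _))] := sp; rewrite scale0r mul0r.
Qed.

(** The functional x |-> inf_(t >= 0) q(x + t y) - t q(y) is still sublinear and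
    below q, and it takes a value at most - q(y) at - y. *)
Lemma sublinear_shift q y : sublinear q -> exists q',
  [/\ sublinear q', forall x, q' x <= q x & forall x, q' x <= q (x + y) - q y].
Proof.
move=> sq; have [qD qZ] := sq.
pose S x := [set q (x + t *: y) - t * q y | t in [set t | 0 <= t]].
have lS z : has_lbound (S z).
  exists (- q (- z)) => _ [t /= t0 <-].
  have := qD (z + t *: y) (- z); rewrite addrAC subrr add0r.
  have := qZ t^-1 (t *: y); rewrite invr_ge0 => /(_ t0).
  have [->|tn0] := eqVneq t 0.
    by rewrite scale0r sublinear0// mul0r; lra.
  have {}t0 : 0 < t by rewrite lt_def tn0.
  by rewrite scalerA mulVf// scale1r ler_pdivlMl//; lra.
exists (fun x => inf (S x)); split.
- apply: sublinear_inf => //.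
  + by move=> z; exists (q (z + 0 *: y) - 0 * q y), 0 => //=.
  + move=> z w _ _ [t /= t0 <-] [u /= u0 <-].
    exists (q (z + w + (t + u) *: y) - (t + u) * q y).
      by exists (t + u) => //=; rewrite addr_ge0.
    by have := qD (z + t *: y) (w + u *: y); rewrite scalerDl addrACA; lra.
  + move=> u z _ u0 [t /= t0 <-].
    exists (q (u *: z + (u * t) *: y) - (u * t) * q y).
      by exists (u * t) => //=; rewrite mulr_ge0.
    by rewrite mulrBr mulrA lerB// -scalerA -scalerDr; exact: qZ.
- move=> x; apply: ge_inf => //.
  by exists 0 => //=; rewrite scale0r addr0 mul0r subr0.
- move=> x; apply: ge_inf => //.
  by exists 1 => //=; rewrite scale1r mul1r.
Qed.

(** A minimal q coincides with its shifts, so that q(x) <= q(x + y) - q(y): this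
    is the missing half of additivity. *)
Lemma minimal_sublinear_linear q : sublinear q ->
  (forall q', sublinear q' -> (forall x, q' x <= q x) -> q' = q) ->
  (forall x y, q (x + y) = q x + q y) /\ (forall t x, q (t *: x) = t * q x).
Proof.
move=> sq qmin; have [qD qZ] := sq.
have addq y x : q x + q y <= q (x + y).
  have [q' [sq' q'q q'y]] := sublinear_shift y sq.
  by rewrite -lerBrDr -{1}(qmin _ sq' q'q).
have qDe x y : q (x + y) = q x + q y by apply/eqP; rewrite eq_le qD addq.
have qN x : q (- x) = - q x.
  by apply/eqP; rewrite -subr_eq0 opprK -qDe addNr sublinear0.
have qZe t x : 0 <= t -> q (t *: x) = t * q x.
  move=> t0; apply/eqP; rewrite eq_le qZ//=.
  by have := qZ t (- x) t0; rewrite scalerN !qN mulrN lerN2.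
split=> // t x.
have [/qZe //|/ltW t0] := leP 0 t.
by have := qZe (- t) x; rewrite oppr_ge0 scaleNr qN mulNr => /(_ t0)/oppr_inj.
Qed.

(** Zorn's lemma applies because the pointwise infimum of a chain is sublinear;
    it is finite since every q <= p satisfies q(x) >= - p(- x). *)
Lemma minimal_sublinear p : sublinear p -> exists q,
  [/\ sublinear q, forall x, q x <= p x &
     forall q', sublinear q' -> (forall x, q' x <= q x) -> q' = q].
Proof.
move=> sp.
pose T := {q : V -> R | sublinear q /\ forall x, q x <= p x}.
pose le (q q' : T) := `[< forall x, sval q' x <= sval q x >].
have [| | | |[q [sq qp]]] := @Zorn T le.
- by move=> q; apply/asboolP.
- move=> q q' q'' /asboolP qq' /asboolP qq''; apply/asboolP => x.
  exact: le_trans (qq'' x) (qq' x).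
- move=> [q hq] [q' hq'] /asboolP/= qq' /asboolP/= q'q; apply: eq_exist.
  by apply/funext => x; apply/eqP; rewrite eq_le qq' q'q.
- move=> A Atot; have [->|/set0P[q0 Aq0]] := eqVneq A set0.
    by exists (exist _ p (conj sp (fun x => lexx _))) => s [].
  pose S x := [set sval q x | q in A].
  have lS x : has_lbound (S x).
    exists (- p (- x)) => _ [[q [sq qp]] _ <-] /=.
    by rewrite (le_trans _ (sublinear_ge x sq))// lerN2.
  have sS : sublinear (fun x => inf (S x)).
    apply: sublinear_inf => //.
    - by move=> x; exists (sval q0 x), q0.
    - move=> x y _ _ [q Aq <-] [q' Aq' <-].
      have [] := Atot _ _ Aq Aq' => /asboolP qq'.
        exists (sval q' (x + y)); first by exists q'.
        by have [[qD _] _] := svalP q'; rewrite (le_trans (qD _ _))// lerD2r.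
      exists (sval q (x + y)); first by exists q.
      by have [[qD _] _] := svalP q; rewrite (le_trans (qD _ _))// lerD2l.
    - move=> t x _ t0 [q Aq <-]; exists (sval q (t *: x)); first by exists q.
      by have [[_ qZ] _] := svalP q; exact: qZ.
  have Sp x : inf (S x) <= p x.
    have [_ q0p] := svalP q0; apply: le_trans (q0p x).
    by apply: ge_inf => //; exists q0.
  exists (exist _ (fun x => inf (S x)) (conj sS Sp)) => q Aq.
  by apply/asboolP => x /=; apply: ge_inf => //; exists q.
move=> qmin; exists q; split=> // q' sq' q'q.
have q'p x : q' x <= p x by exact: le_trans (q'q x) (qp x).
by have /= := qmin (exist _ q' (conj sq' q'p)) (asboolT q'q) => -[].
Qed.

(** A minimal functional below the shift of p along g is linear, and the shift
    forces its value at g. *)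
Lemma hahn_banach p g : sublinear p ->
  exists L : V -> R, [/\ forall x y, L (x + y) = L x + L y,
    forall t x, L (t *: x) = t * L x, forall x, L x <= p x & L g = p g].
Proof.
move=> sp; have [p' [sp' p'p p'g]] := sublinear_shift g sp.
have [L [sL Lp' Lmin]] := minimal_sublinear sp'.
have Lp x : L x <= p x := le_trans (Lp' x) (p'p x).
have [LD LZ] := minimal_sublinear_linear sL Lmin.
exists L; split => //.
apply/eqP; rewrite eq_le Lp/=.
have := le_trans (Lp' (- g)) (p'g (- g)).
by rewrite addNr sublinear0//; have := sublinear_ge g sL; lra.
Qed.

End hahn_banach.

(** * Closedness and inversion in a uniform algebra *)

Lemma geometric_step (L : fieldType) (z w : L) : 1 - z != 0 ->
  1 + z * ((1 - w) / (1 - z)) = (1 - z * w) / (1 - z).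
Proof. by move=> z1; field. Qed.

Lemma geometric_rem (L : fieldType) (z w : L) : 1 - z != 0 ->
  (1 - z)^-1 - (1 - w) / (1 - z) = w / (1 - z).
Proof. by move=> z1; field. Qed.

Lemma rescaled_inv (L : fieldType) (z w : L) : z != 0 ->
  z * (1 - (1 - z * w))^-1 = w^-1.
Proof. by move=> z0; rewrite subKr invfM mulrA mulfV// mul1r. Qed.

Section uniform_algebra_theory.
Variables (R : realType) (k : scalar_kind) (K : compactHausdorffType).
Variable X : uniform_algebra K R k.
Local Notation F := (scalars R k).
Local Notation C := (cfun K R k).

Lemma cfunDE (f g : C) t : cfun_val (f + g) t = f t + g t. Proof. by []. Qed.
Lemma cfunNE (f : C) t : cfun_val (- f) t = - f t. Proof. by []. Qed.
Lemma cfunBE (f g : C) t : cfun_val (f - g) t = f t - g t. Proof. by []. Qed.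
Lemma cfunME (f g : C) t : cfun_val (f * g) t = f t * g t. Proof. by []. Qed.
Lemma cfunZE c (f : C) t : cfun_val (c *: f) t = c * f t. Proof. by []. Qed.

Lemma cfun_bounded (f : C) : exists B : R, forall t, nrm (f t) <= B.
Proof.
exists (re (cfun_norm f)) => t.
by rewrite -(ler_rc k) -normE -ge0_rc ?cfun_norm_ge0// cfun_norm_ge.
Qed.

Lemma ua_cstP (c : F) : exists2 g, ua_set X g & forall t, g t = c.
Proof. by exists (cst c : continuousType K F) => //; exact: ua_cst. Qed.

Lemma ua_opp f : ua_set X f -> ua_set X (- f).
Proof. by move=> Xf; rewrite -scaleN1r; exact: ua_scale. Qed.

Lemma ua_sub f g : ua_set X f -> ua_set X g -> ua_set X (f - g).
Proof. by move=> Xf Xg; apply: ua_add => //; exact: ua_opp. Qed.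

(** The form in which closedness of X is used: uniform limits stay in X. *)
Lemma ua_approx (f : C) :
  (forall e : R, 0 < e -> exists2 g, ua_set X g &
     forall t, nrm (f t - g t) <= e) -> ua_set X f.
Proof.
move=> fX; apply: (@ua_closed _ _ _ X) => A /nbhs_normP[i /= i0 iA].
have ie := ge0_rc (ltW i0).
have ri0 : 0 < re i / 2 by rewrite divr_gt0// -(ltr_rc k) -ie rc0.
have [g Xg fg] := fX _ ri0; exists g; split=> //; apply: iA => /=.
apply: (@le_lt_trans _ _ (rc k (re i / 2))); last by rewrite [ltRHS]ie ltr_rc; lra.
apply: cfun_norm_le; first by rewrite -rc0 ler_rc ltW.
by move=> t; rewrite normE ler_rc; exact: fg.
Qed.

Lemma ua_neumann_sum g n : ua_set X g -> (forall t, g t != 1) ->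
  exists2 S, ua_set X S & forall t, S t = (1 - g t ^+ n) / (1 - g t).
Proof.
move=> Xg g1; elim: n => [|n [S XS SE]].
  by have [z Xz zE] := ua_cstP 0; exists z => // t; rewrite zE subrr mul0r.
have [u Xu uE] := ua_cstP 1; exists (u + g * S).
  by apply: ua_add => //; exact: ua_mul.
move=> t; have t0 : 1 - g t != 0 by rewrite subr_eq0 eq_sym.
by rewrite cfunDE cfunME uE SE exprS geometric_step.
Qed.

Lemma inv_continuous (f : K -> F) : continuous f -> (forall t, f t != 0) ->
  continuous (fun t => (f t)^-1).
Proof. by move=> cf f0 t; apply: cvgV => //; exact: cf. Qed.

(** The inverse is known pointwise and continuous, so only its uniform
    approximation by the partial sums of the geometric series is needed. *)
Lemma ua_neumann g (r : R) : 0 <= r -> r < 1 -> ua_set X g ->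
  (forall t, nrm (g t) <= r) ->
  exists2 h, ua_set X h & forall t, h t = (1 - g t)^-1.
Proof.
move=> r0 r1 Xg gr.
have nge t : 1 - r <= nrm (1 - g t).
  have := nrmD (1 - g t) (g t); rewrite subrK nrm1.
  by have := gr t; lra.
have g1 t : 1 - g t != 0 by rewrite -nrm_gt0; have := nge t; lra.
have [u Xu uE] := ua_cstP 1.
have ch : continuous (fun t => (1 - g t)^-1).
  apply: inv_continuous => // t; apply: cvgB; first exact: cvg_cst.
  exact: (@cts_fun K F g).
exists (mkcts ch : continuousType K F) => //.
apply: ua_approx => e e0.
have [n rn] : exists n, r ^+ n <= e * (1 - r).
  have /cvgrPdist_le : (fun n => r ^+ n) @ \oo --> (0 : R).
    by apply: cvg_expr; rewrite ger0_norm.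
  have er0 : 0 < e * (1 - r) by rewrite mulr_gt0// subr_gt0.
  move=> /(_ _ er0)[n _ /(_ n (leqnn n))]; rewrite sub0r normrN => rn.
  by exists n; rewrite (le_trans (ler_norm _)).
have [|S XS SE] := @ua_neumann_sum g n Xg.
  by move=> t; have := g1 t; rewrite subr_eq0 eq_sym.
exists S => // t; rewrite SE/=.
rewrite geometric_rem//.
rewrite nrmM nrmV nrmX ler_pdivrMr; last by rewrite nrm_gt0.
apply: le_trans (le_trans _ rn) _; first by rewrite lerXn2r// nnegrE nrm_ge0.
by rewrite ler_pM2l.
Qed.

(** The values of d lie in a bounded part of the half plane Re z >= a, hence in a
    disc centred at a large real c and avoiding 0 uniformly: d / c is then within
    distance r < 1 of 1 and the geometric series inverts it. *)
Lemma ua_inv d (a : R) : 0 < a -> ua_set X d -> (forall t, a <= re (d t)) ->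
  exists2 g, ua_set X g & forall t, g t = (d t)^-1.
Proof.
move=> a0 Xd ad; have [B0 dB0] := cfun_bounded d.
have [B [aB dB]] : exists B, a <= B /\ forall t, nrm (d t) <= B.
  exists (Num.max a B0); split=> [|t]; first by rewrite le_max lexx.
  by rewrite le_max dB0 orbT.
(* this c turns |c - z|^2 <= c^2 - 2 c a + B^2 into |c - z|^2 <= c^2 - c a *)
pose c := B ^+ 2 / a.
have ca : c * a = B ^+ 2 by rewrite mulfVK// gt_eqF.
have B0' : 0 < B by lra.
have c0 : 0 < c by rewrite divr_gt0// exprn_gt0.
have cB : a <= c by rewrite ler_pdivlMr// expr2 ler_pM// ltW.
pose r := 1 - a / (2 * c).
have ac : a / (2 * c) <= 1 by rewrite ler_pdivrMr; lra.
have ac0 : 0 < a / (2 * c) by rewrite divr_gt0//; lra.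
have [u Xu uE] := ua_cstP 1.
pose g : C := u - rc k c^-1 *: d.
have Xg : ua_set X g by apply: ua_sub => //; exact: ua_scale.
have gE t : g t = 1 - rc k c^-1 * d t.
  by rewrite /g cfunBE cfunZE uE.
have gr t : nrm (g t) <= r.
  rewrite -(@ler_pXn2r _ 2)// ?nnegrE ?nrm_ge0 /r//; last lra.
  have dt : re (d t) ^+ 2 + im (d t) ^+ 2 <= c * a.
    rewrite -nrm_sqr ca lerXn2r ?nnegrE ?nrm_ge0//; lra.
  rewrite nrm_sqr gE reB imB re1 im1 reM imM re_rc im_rc !mul0r subr0 sub0r.
  rewrite addr0.
  have -> : (1 - c^-1 * re (d t)) ^+ 2 + (- (c^-1 * im (d t))) ^+ 2 =
    1 - 2 * re (d t) / c + (re (d t) ^+ 2 + im (d t) ^+ 2) / c ^+ 2.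
    by field; lra.
  have : (re (d t) ^+ 2 + im (d t) ^+ 2) / c ^+ 2 <= a / c.
    rewrite ler_pdivrMr ?exprn_gt0// (le_trans dt)//.
    have -> : a / c * c ^+ 2 = c * a by field; lra.
    by [].
  have : a / c <= re (d t) / c by rewrite ler_pM2r// invr_gt0.
  have -> : a / (2 * c) = a / c / 2 by field; lra.
  have := sqr_ge0 (a / c); nra.
have [||h Xh hE] := @ua_neumann g r _ _ Xg gr; rewrite /r; [lra|lra|].
exists (rc k c^-1 *: h); first exact: ua_scale.
move=> t; rewrite cfunZE hE gE rescaled_inv//.
by apply/eqP => /(congr1 (@re R k)); rewrite re_rc re0 => /eqP; rewrite invr_eq0; lra.
Qed.

End uniform_algebra_theory.

(** * Functionals representing a Choquet boundary point *)

Section choquet_points.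
Variables (R : realType) (k : scalar_kind) (K : compactHausdorffType).
Variable X : uniform_algebra K R k.
Local Notation F := (scalars R k).
Local Notation C := (cfun K R k).
Local Notation CR := (cfun K R RealScalars).

(** The scalar field of C(K, R) is R only up to unfolding of [scalars]; this names
    the space as a module over R itself, and [rval], [rfun] and [rscale] give its
    elements, evaluations and multiples the expected types. *)
Definition real_cfun : lmodType R :=
  (CR : lmodType (scalars R RealScalars)).

Definition rval (g : CR) (t : K) : R := g t.
Definition rfun (f : K -> R) (cf : continuous f) : CR :=
  (mkcts cf : continuousType K R).

Definition rscale (c : R) (g : CR) : CR := (c : scalars R RealScalars) *: g.

Lemma rscaleN1 g : rscale (-1) g = - g. Proof. exact: scaleN1r. Qed.

Lemma rfun_ext (g h : CR) : (forall t, rval g t = rval h t) -> g = h.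
Proof. by move=> gh; apply/continuousEP => t; exact: gh. Qed.

Lemma comp_re_continuous (f : C) : continuous (fun t => re (f t)).
Proof.
by move=> t; apply: continuous_comp; [exact: (@cts_fun K F f)|exact: re_continuous].
Qed.

Lemma comp_im_continuous (f : C) : continuous (fun t => im (f t)).
Proof.
by move=> t; apply: continuous_comp; [exact: (@cts_fun K F f)|exact: im_continuous].
Qed.

Definition reC (f : C) : CR := rfun (@comp_re_continuous f).
Definition imC (f : C) : CR := rfun (@comp_im_continuous f).

Lemma rvalE : (forall g h t, rval (g + h) t = rval g t + rval h t) *
  (forall g h t, rval (g * h) t = rval g t * rval h t) *
  (forall c g t, rval (rscale c g) t = c * rval g t) *
  (forall g t, rval (- g) t = - rval g t) *
  (forall t, rval 0 t = 0) *
  (forall t, rval 1 t = 1) *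
  (forall f t, rval (reC f) t = re (f t)) *
  (forall f t, rval (imC f) t = im (f t)).
Proof. by []. Qed.

Variable s : K.

Definition majorant_values (g : CR) : set R :=
  [set re (q s) | q in [set q : C | ua_set X q /\ forall t, rval g t <= re (q t)]].

(** In the language of measures, the largest integral of g against a measure
    representing s. *)
Definition majorant_inf (g : CR) : R := inf (majorant_values g).

Lemma majorant_values_lb g : has_lbound (majorant_values g).
Proof.
have [B gB] := cfun_bounded g.
exists (- B) => _ [q [_ gq] <-]; apply: le_trans (gq s).
by have := le_trans (re_le_nrm (g s)) (gB s); rewrite ler_norml => /andP[].
Qed.

Lemma majorant_values_neq0 g : majorant_values g !=set0.
Proof.
have [B gB] := cfun_bounded g; have [q Xq qE] := ua_cstP X (rc k B).
exists (re (q s)), q => //; split=> // t; rewrite qE re_rc.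
by have := le_trans (re_le_nrm (g t)) (gB t); rewrite ler_norml => /andP[].
Qed.

Lemma majorant_inf_sublinear : sublinear (V := real_cfun) majorant_inf.
Proof.
apply: (@sublinear_inf R real_cfun).
- exact: majorant_values_neq0.
- exact: majorant_values_lb.
- move=> g h _ _ [q [Xq gq] <-] [r [Xr hr] <-].
  exists (re ((q + r : C) s)); last by rewrite cfunDE reD.
  exists (q + r) => //; split=> [|t]; first exact: ua_add.
  by rewrite cfunDE reD rvalE lerD.
- move=> c g _ c0 [q [Xq gq] <-].
  exists (re ((rc k c *: q : C) s)); last by rewrite cfunZE reM re_rc im_rc mul0r subr0.
  exists (rc k c *: q) => //; split=> [|t]; first exact: ua_scale.
  by rewrite cfunZE reM re_rc im_rc mul0r subr0 rvalE ler_wpM2l.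
Qed.

Lemma majorant_inf_le (g : CR) q : ua_set X q -> (forall t, rval g t <= re (q t)) ->
  majorant_inf g <= re (q s).
Proof.
by move=> Xq gq; apply: ge_inf; [exact: majorant_values_lb|exists q].
Qed.

(** A representing measure of s, seen as a positive functional on C(K, R). *)
Record represents (L : CR -> R) : Prop := Represents {
  rep_add : forall g h, L (g + h) = L g + L h;
  rep_scale : forall c g, L (rscale c g) = c * L g;
  rep_ge0 : forall g, (forall t, 0 <= rval g t) -> 0 <= L g;
  rep_re : forall f, ua_set X f -> L (reC f) = re (f s) }.

Lemma majorant_represents L : (forall g h, L (g + h) = L g + L h) ->
  (forall c g, L (rscale c g) = c * L g) -> (forall g, L g <= majorant_inf g) ->
  represents L.
Proof.
move=> LD LZ Lp.
have LN g : L (- g) = - L g by rewrite -rscaleN1 LZ mulN1r.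
have [z Xz zE] := ua_cstP X 0.
split=> // [g g0|f Xf].
  rewrite -oppr_le0 -LN (le_trans (Lp _))//.
  have <- : re (z s) = 0 by rewrite zE re0.
  by apply: majorant_inf_le => // t; rewrite zE re0 rvalE oppr_le0.
apply/eqP; rewrite eq_le; apply/andP; split.
  by rewrite (le_trans (Lp _))// majorant_inf_le.
rewrite -lerN2 -LN (le_trans (Lp _))// -reN -cfunNE majorant_inf_le//.
  exact: ua_opp.
by move=> t; rewrite cfunNE reN.
Qed.

Section weighted.
Variable L : CR -> R.
Hypothesis repL : represents L.

Let repD := rep_add repL.
Let repZ := rep_scale repL.
Let repR := rep_re repL.

Lemma repB g h : L (g - h) = L g - L h.
Proof. by rewrite repD -rscaleN1 repZ mulN1r. Qed.

Lemma rep_le g h : (forall t, rval g t <= rval h t) -> L g <= L h.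
Proof.
move=> gh; rewrite -subr_ge0 -repB; apply: (rep_ge0 repL) => // t.
by rewrite !rvalE subr_ge0.
Qed.

Lemma rep1 : L 1 = 1.
Proof.
have [u Xu uE] := ua_cstP X 1.
rewrite -(_ : reC u = 1); first by rewrite repR// uE re1.
by apply: rfun_ext => t; rewrite !rvalE uE re1.
Qed.

(** Im f is the real part of -i f, which belongs to X too (and Im f = 0 for real
    scalars, where [mk k 0 (-1)] is 0). *)
Lemma rep_im f : ua_set X f -> L (imC f) = im (f s).
Proof.
move=> Xf; have mi z : re (mk k 0 (-1) * z) = im z.
  rewrite /mk /re /im; case: k z => /=; first by move=> z; rewrite mul0r.
  by move=> [a b] /=; rewrite mul0r sub0r mulN1r opprK.
rewrite -mi -cfunZE -repR; last exact: ua_scale.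
by congr L; apply: rfun_ext => t; rewrite !rvalE cfunZE mi.
Qed.

(** The functional on X attached to the measure of density w with respect to L,
    normalized to have mass 1. *)
Definition weighted (w : CR) (f : ua_type X) : F :=
  mk k (L (w * reC f) / L w) (L (w * imC f) / L w).

Lemma weighted_linear w : linear (weighted w).
Proof.
move=> a f g; rewrite /weighted.
have -> : w * reC (ua_val (a *: f + g)) =
   rscale (re a) (w * reC f) - rscale (im a) (w * imC f) + w * reC g.
  apply: rfun_ext => t; rewrite !rvalE /=.
  rewrite -[RHS]/(_ + _) reD reM; ring.
have -> : w * imC (ua_val (a *: f + g)) =
   rscale (re a) (w * imC f) + rscale (im a) (w * reC f) + w * imC g.
  apply: rfun_ext => t; rewrite !rvalE /=.
  rewrite imD imM; ring.
by rewrite repD repB !repD !repZ !mulrDl mulNr mkD -!mulrA -mulmk.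
Qed.

(** After rotation the value is real, and positivity of L bounds it by the mean
    of the real part of the rotated function. *)
Lemma weighted_le w (f : ua_type X) B : (forall t, 0 <= rval w t) -> 0 < L w ->
  (forall t, nrm (f t) <= B) -> nrm (weighted w f) <= B.
Proof.
move=> w0 Lw0 fB; have [l l1 lf] := nrm_rot (weighted w f).
have <- : re (l * weighted w f) = nrm (weighted w f) by rewrite lf re_rc.
have -> : l * weighted w f = weighted w (l *: f).
  have w0E : weighted w 0 = 0.
    by have := weighted_linear w (-1) 0 0; rewrite scaler0 addr0 scaleN1r addNr.
  by have := weighted_linear w l f 0; rewrite addr0 w0E addr0 => ->.
rewrite re_mk ler_pdivrMr// -repZ; apply: rep_le => t; rewrite !rvalE mulrC.
apply: ler_wpM2r => //; apply: le_trans (fB t).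
apply: le_trans (ler_norm _) (le_trans (re_le_nrm _) _).
by rewrite [ua_val _ _]/(l * f t) nrmM l1 mul1r.
Qed.

Lemma ua_norm_nrm (f : ua_type X) t : nrm (f t) <= re `|f|.
Proof. by rewrite -(ler_rc k) -normE -ge0_rc ?normr_ge0//; exact: cfun_norm_ge. Qed.

Lemma weighted_dual w : (forall t, 0 <= rval w t) -> 0 < L w ->
  dual_unit_ball (E := ua_type X) (weighted w).
Proof.
move=> w0 Lw0; split; [split; first exact: weighted_linear|].
  move=> f; apply/(@cvgrPdist_lt _ _ _ (nbhs f)) => e e0.
  apply/(@nbhs_normP F (ua_type X)); exists e => //= g /= fge.
  have -> : weighted w f - weighted w g = weighted w (f - g).
    by have := weighted_linear w (-1) g f; rewrite !scaleN1r ![- _ + _]addrC.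
  rewrite normE; apply: le_lt_trans fge.
  rewrite [leRHS]ge0_rc ?normr_ge0// ler_rc.
  by apply: weighted_le => // t; exact: ua_norm_nrm.
move=> f /= f1; rewrite normE -(rc1 R k) ler_rc; apply: weighted_le => // t.
by rewrite -(ler_rc k) rc1 -normE (le_trans _ f1)//; exact: cfun_norm_ge.
Qed.

(** Evaluation at s is a convex combination of the functionals of weights 1 + u
    and 1 - u; as it is extreme, both equal it, so that u L represents s up to
    the factor L(u). *)
Lemma rep_mul_re (u : CR) f : choquet_boundary X s ->
  (forall t, `|rval u t| <= 2^-1) -> ua_set X f -> f s = 0 ->
  L (u * reC f) = 0.
Proof.
move=> [_ ext] u1 Xf fs.
have hu t : - 2^-1 <= rval u t <= 2^-1 by rewrite -ler_norml.
have wp (w : CR) : (forall t, 2^-1 <= rval w t) ->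
    (forall t, 0 <= rval w t) /\ 2^-1 <= L w.
  move=> w2; split=> [t|]; first by apply: le_trans (w2 t); rewrite invr_ge0.
  have : L (rscale 2^-1 1) <= L w.
    by apply: rep_le => t; rewrite !rvalE mulr1.
  by rewrite repZ rep1 mulr1.
have [wp0 Lwp] : (forall t, 0 <= rval (1 + u) t) /\ 2^-1 <= L (1 + u).
  by apply: wp => t; have := hu t; rewrite !rvalE; lra.
have [wm0 Lwm] : (forall t, 0 <= rval (1 - u) t) /\ 2^-1 <= L (1 - u).
  by apply: wp => t; have := hu t; rewrite !rvalE; lra.
have hp : 0 < L (1 + u) by apply: lt_le_trans Lwp; rewrite invr_gt0.
have hm : 0 < L (1 - u) by apply: lt_le_trans Lwm; rewrite invr_gt0.
have ht : L (1 + u) / 2 + L (1 - u) / 2 = 1.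
  by rewrite -mulrDl -repD addrACA subrr addr0 repD rep1; lra.
have [] := ext (weighted (1 + u)) (weighted (1 - u)) (rc k (L (1 + u) / 2)).
- exact: weighted_dual.
- exact: weighted_dual.
- by rewrite -(rc0 R k) -(rc1 R k) !ltr_rc; lra.
- apply/funext => g /=.
  have Xg : ua_set X g by case: (g) => v /= /set_mem.
  rewrite -(rc1 R k) -rcB.
  have -> : 1 - L (1 + u) / 2 = L (1 - u) / 2 by lra.
  rewrite -[RHS]/(rc k (L (1 + u) / 2) * weighted (1 + u) g +
    rc k (L (1 - u) / 2) * weighted (1 - u) g).
  rewrite !mulmk !re_rc !im_rc !mul0r !subr0 !addr0 -mkD -[LHS]mkE.
  have E a b : L a != 0 -> L a / 2 * (L b / L a) = L b / 2.
    by move=> a0; field.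
  rewrite !E ?gt_eqF// -!mulrDl -!repD -!mulrDl addrACA subrr addr0.
  rewrite !mulrDl !mul1r !repD repR// rep_im//.
  by congr mk; field.
move=> /(congr1 (fun phi => re (phi (UAType (mem_set Xf))))) + _.
rewrite /= re_mk fs re0 => /eqP; rewrite mulf_eq0 invr_eq0 (gt_eqF hp) orbF.
by rewrite mulrDl mul1r repD repR// fs re0 add0r => /eqP.
Qed.

(** So a measure representing a boundary point s does not charge the set where
    Re f is not 0, for any f in X vanishing at s. *)
Lemma rep_sqr_re f : choquet_boundary X s -> ua_set X f -> f s = 0 ->
  L (reC f * reC f) = 0.
Proof.
move=> cs Xf fs; have [B fB] := cfun_bounded f.
have B0 : 0 <= B by rewrite (le_trans _ (fB s))// nrm_ge0.
pose c := (2 * (B + 1))^-1.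
have c0 : 0 < c by rewrite invr_gt0; lra.
have : L (rscale c (reC f) * reC f) = 0.
  apply: rep_mul_re => // t; rewrite !rvalE normrM gtr0_norm//.
  rewrite /c invfM -mulrA ger_pMr ?invr_gt0// ler_pdivrMl; last lra.
  by have := le_trans (re_le_nrm (f t)) (fB t); lra.
have -> : rscale c (reC f) * reC f = rscale c (reC f * reC f).
  by apply: rfun_ext => t; rewrite !rvalE mulrA.
by rewrite repZ => /eqP; rewrite mulf_eq0 gt_eqF//= => /eqP.
Qed.

End weighted.

(** The Hahn-Banach functional attaining the infimum of the majorants represents
    s, and such functionals vanish at (Re f)^2. *)
Lemma choquet_sqr_majorant f (e : R) : choquet_boundary X s ->
  ua_set X f -> f s = 0 -> 0 < e ->
  exists q, [/\ ua_set X q, forall t, re (f t) ^+ 2 <= re (q t) & re (q s) < e].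
Proof.
move=> cs Xf fs e0.
have [L [LD LZ Lp Lg]] :=
  @hahn_banach R real_cfun _ (reC f * reC f) majorant_inf_sublinear.
have repL := majorant_represents LD LZ Lp.
have : majorant_inf (reC f * reC f) < e by rewrite -Lg rep_sqr_re.
case/(inf_lt (majorant_values_neq0 _)) => _ [q [Xq gq] <-] qe.
by exists q; split=> // t; rewrite expr2; exact: gq.
Qed.

End choquet_points.

(** * Peak functions at Choquet boundary points *)

Lemma half_pow_le (R : realType) (e : R) : 0 < e -> exists n, 2^-1 ^+ n <= e.
Proof.
move=> e0; have /cvgrPdist_le : (fun n => 2^-1 ^+ n) @ \oo --> (0 : R).
  by apply: cvg_expr; rewrite ger0_norm ?invr_ge0// invf_lt1 ?ltr1n.
move=> /(_ _ e0)[n _ /(_ n (leqnn n))]; rewrite sub0r normrN => rn.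
by exists n; rewrite (le_trans (ler_norm _)).
Qed.

Lemma le_half_pow (R : realType) (a b M : R) :
  (forall n, a <= b + M * 2^-1 ^+ n) -> a <= b.
Proof.
move=> abM; rewrite leNgt; apply/negP => ba.
pose M' := `|M| + 1; have M'0 : 0 < M' by rewrite ltr_wpDl.
have [|n] := @half_pow_le R ((a - b) / 2 / M').
  by rewrite !divr_gt0// subr_gt0.
rewrite ler_pdivlMr// => nM; have := abM n.
have : M * 2^-1 ^+ n <= 2^-1 ^+ n * M'.
  rewrite mulrC ler_wpM2l ?exprn_ge0 ?invr_ge0//.
  by rewrite (le_trans (ler_norm _))// lerDl.
lra.
Qed.

(** A Cauchy sequence with an explicit rate: the limit is the supremum of the lower
    bounds v(n) - e(n), which the rate keeps below every v(m) + e(m). *)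
Lemma rate_limit (R : realType) (v e : nat -> R) : (forall n, 0 <= e n) ->
  (forall n m, (n <= m)%N -> `|v m - v n| <= e n) ->
  exists L, forall n, `|L - v n| <= e n.
Proof.
move=> e0 ve.
have vlt n m : v n - e n <= v m + e m.
  have [nm|/ltnW mn] := leqP n m.
    by have := ve _ _ nm; have := e0 m; rewrite ler_norml => + /andP[]; lra.
  by have := ve _ _ mn; have := e0 n; rewrite ler_norml => + /andP[]; lra.
pose A := range (fun n => v n - e n).
exists (sup A) => n; rewrite ler_distl; apply/andP; split.
  by apply: ub_le_sup; [exists (v 0%N + e 0%N) => _ [m _ <-]|exists n].
by apply: ge_sup; [exists (v 0%N - e 0%N), 0%N|move=> _ [m _ <-]].
Qed.

Section peaks.
Variables (R : realType) (k : scalar_kind) (K : compactHausdorffType).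
Variable X : uniform_algebra K R k.
Local Notation F := (scalars R k).
Local Notation C := (cfun K R k).

(** Completeness of X.  The factor 2 comes from treating real and imaginary parts
    separately. *)
Lemma ua_limit (S : nat -> C) (e : nat -> R) : (forall n, ua_set X (S n)) ->
  (forall n, 0 <= e n) -> (forall d, 0 < d -> exists n, e n <= d) ->
  (forall n m t, (n <= m)%N -> nrm (S m t - S n t) <= e n) ->
  exists2 f, ua_set X f & forall n t, nrm (f t - S n t) <= 2 * e n.
Proof.
move=> XS e0 elim Se.
have /choice[f fS] t : exists z, forall n, nrm (z - S n t) <= 2 * e n.
  have [a aS] : exists a, forall n, `|a - re (S n t)| <= e n.
    apply: (rate_limit (v := fun n => re (S n t))) => // n m nm.
    by rewrite -reB (le_trans (re_le_nrm _))// Se.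
  have [b bS] : exists a, forall n, `|a - im (S n t)| <= e n.
    apply: (rate_limit (v := fun n => im (S n t))) => // n m nm.
    by rewrite -imB (le_trans (im_le_nrm _))// Se.
  exists (mk k a b) => n.
  have -> : mk k a b - S n t = mk k (a - re (S n t)) (b - im (S n t)).
    by rewrite mkD -[in LHS](mkE (S n t)) -[- mk _ _ _]mkE reN imN mkE.
  by apply: le_trans (nrm_mk _ _ _) _; have := aS n; have := bS n; lra.
have cf : continuous f.
  move=> t; apply/(@cvgrPdist_lt _ _ _ (nbhs t)) => d d0.
  have dE := ge0_rc (ltW d0).
  have rd0 : 0 < re d by rewrite -(ltr_rc k) -dE rc0.
  have [|n en] := elim (re d / 8); first by rewrite divr_gt0.
  near=> u.
  rewrite normE dE ltr_rc.
  have -> : f t - f u = (f t - S n t) + ((S n t - S n u) + (S n u - f u)).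
    by rewrite !subrKA.
  apply: le_lt_trans (nrmD _ _) _.
  have -> : re d = re d / 4 + 3 * (re d / 4) by lra.
  apply: ler_ltD; first by apply: le_trans (fS t n) _; lra.
  apply: le_lt_trans (nrmD _ _) _.
  have -> : 3 * (re d / 4) = re d / 2 + re d / 4 by lra.
  apply: ltr_leD; last by rewrite nrmBC (le_trans (fS u n))//; lra.
  rewrite -(ltr_rc k) -normE; near: u.
  apply: cvgr_dist_lt; last by rewrite -(rc0 R k) ltr_rc divr_gt0.
  exact: (@cts_fun K F (S n)).
exists (mkcts cf : continuousType K F) => //.
apply: ua_approx => d d0; have [|n en] := elim (d / 2); first by rewrite divr_gt0.
exists (S n) => // t; apply: le_trans (fS t n) _; lra.
Unshelve. all: by end_near. Qed.

Variable s : K.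
Hypothesis cs : choquet_boundary X s.

(** The functions whose upper envelope by Re X is non-positive at s.  They form a
    cone, and contain enough squares to separate s from the other points. *)
Definition negligible (g : K -> R) := forall e : R, 0 < e ->
  exists q, [/\ ua_set X q, forall t, g t <= re (q t) & re (q s) < e].

Lemma negligibleD g h : negligible g -> negligible h ->
  negligible (fun t => g t + h t).
Proof.
move=> ng nh e e0; have e20 : 0 < e / 2 by rewrite divr_gt0.
have [q [Xq gq qe]] := ng _ e20; have [r [Xr hr re']] := nh _ e20.
exists (q + r); split; first exact: ua_add.
  by move=> t; rewrite cfunDE reD lerD.
by rewrite cfunDE reD; lra.
Qed.

Lemma negligible_sqr f : ua_set X f -> f s = 0 ->
  negligible (fun t => re (f t) ^+ 2).
Proof. by move=> Xf fs e e0; exact: choquet_sqr_majorant. Qed.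

Lemma separating_at t : t <> s ->
  exists f, [/\ ua_set X f, f s = 0 & re (f t) != 0].
Proof.
move=> ts; have [f Xf fts] := ua_separates X ts.
have [u Xu uE] := ua_cstP X (f s).
have [l _ lz] := nrm_rot (f t - f s).
exists (l *: (f - u)); split; first by apply: ua_scale; exact: ua_sub.
  by rewrite cfunZE cfunBE uE subrr mulr0.
by rewrite cfunZE cfunBE uE lz re_rc nrm_eq0 subr_eq0; apply/eqP.
Qed.

(** Near each point t off U, a multiple of (Re f)^2 exceeds M, for an f in X
    vanishing at s with Re f(t) different from 0.  Compactness then yields a
    finite sum that works off U: it is expressed by the filter of the negligible
    functions that are large enough, which is directed as they may be added. *)
Lemma negligible_ge (U : set K) (M : R) : open U -> U s ->
  exists g, [/\ negligible g, forall t, 0 <= g t & forall t, ~ U t -> M <= g t].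
Proof.
move=> oU Us.
pose D := [set g : K -> R | negligible g /\ forall t, 0 <= g t].
pose B (g : K -> R) := [set g' | D g' /\ forall t, g t <= g' t].
have FF : Filter (filter_from D B).
  apply: filter_from_filter.
    exists (fun=> 0); split=> // e e0; have [z Xz zE] := ua_cstP X 0.
    by exists z; split=> // [t|]; rewrite zE re0.
  move=> g h [ng g0] [nh h0]; exists (fun t => g t + h t).
    by split; [exact: negligibleD|move=> t; rewrite addr_ge0].
  move=> g' [Dg' ghg']; split; split=> // t; apply: le_trans (ghg' t).
    by rewrite lerDl.
  by rewrite lerDr.
have cU : compact (~` U).
  by apply: subclosed_compact (@compact_setT K) _ => //; exact: open_closedC.
have /compact_near_coveringP := cU.
move=> /(_ _ (filter_from D B) (fun g t => M <= g t) FF)[].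
  move=> t Ut; have [|f [Xf fs ft]] := @separating_at t.
    by move=> tsE; apply: Ut; rewrite tsE.
  pose c := 2 * (`|M| + 1) / re (f t) ^+ 2.
  have M0 : 0 < `|M| + 1 by rewrite ltr_wpDl.
  have ft0 : 0 < re (f t) ^+ 2 by rewrite exprn_even_gt0.
  have c0 : 0 <= c by rewrite ltW// divr_gt0// mulr_gt0.
  pose fc : C := rc k (Num.sqrt c) *: f.
  have fcE u : re (fc u) ^+ 2 = c * re (f u) ^+ 2.
    by rewrite /fc cfunZE reM re_rc im_rc mul0r subr0 exprMn sqr_sqrtr.
  pose g u := re (fc u) ^+ 2.
  have Dg : D g.
    split=> [|u]; last exact: sqr_ge0.
    apply: negligible_sqr; first exact: ua_scale.
    by rewrite /fc cfunZE fs mulr0.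
  exists ([set u | M <= g u], B g).
    split; last by exists g.
    have cg : {for t, continuous g}.
      rewrite (_ : g = fun u => re (fc u) * re (fc u)); last first.
        by apply/funext => u; rewrite -expr2.
      by apply: cvgM; exact: comp_re_continuous.
    have Mg : M < g t.
      rewrite /g fcE /c divfK ?gt_eqF//.
      by have := ler_norm M; lra.
    near=> u; apply: ltW; near: u.
    exact: (cvgr_gt _ cg).
  by move=> [u h] /= [Mu [_ gh]]; exact: le_trans (gh u).
move=> g [ng g0] /(_ g) gM.
by exists g; split=> // t Ut; apply: gM.
Unshelve. all: by end_near. Qed.

(** Once q(s) is made real by subtracting a constant, (1 + q(s)) / (1 + q) is
    bounded by 1 + Re q(s) when Re q >= 0, and is small where Re q is large. *)
Lemma approx_peak (U : set K) : open U -> U s -> exists h,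
  [/\ ua_set X h, h s = 1, forall t, nrm (h t) <= 5 / 4 &
      forall t, ~ U t -> nrm (h t) <= 4^-1].
Proof.
move=> oU Us; have [g [ng g0 gU]] := negligible_ge 4 oU Us.
have [|q [Xq gq qs]] := ng 4^-1; first by rewrite invr_gt0.
have q0 t : 0 <= re (q t) by exact: le_trans (gq t).
set r := re (q s) in qs.
have r0 : 0 <= r by exact: q0.
(* the constant makes the denominator d real at s, with value 1 + Re q(s) *)
have [u Xu uE] := ua_cstP X (rc k (1 + r) - q s).
pose d : C := u + q.
have dre t : re (d t) = 1 + re (q t).
  by rewrite /d cfunDE uE reD reB re_rc -/r; lra.
have [||e Xe eE] := @ua_inv _ _ _ X d 1 ltr01; first exact: ua_add.
  by move=> t; rewrite dre lerDl.
have dnrm t : 1 + re (q t) <= nrm (d t).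
  by rewrite -dre (le_trans (ler_norm _))// re_le_nrm.
have hE t : nrm ((rc k (1 + r) *: e : C) t) = (1 + r) / nrm (d t).
  by rewrite cfunZE eE nrmM nrmV nrm_rc ger0_norm//; lra.
have dpos t : 0 < nrm (d t) by have := dnrm t; have := q0 t; lra.
exists (rc k (1 + r) *: e); split; first exact: ua_scale.
- rewrite cfunZE eE /d cfunDE uE subrK mulfV//.
  by rewrite -nrm_eq0 nrm_rc normr_eq0; lra.
- by move=> t; rewrite hE ler_pdivrMr//; have := dnrm t; have := q0 t; lra.
- move=> t Ut; rewrite hE ler_pdivrMr//.
  by have := dnrm t; have := le_trans (gU t Ut) (gq t); lra.
Qed.

(** A partial sum of the peaking series, still missing c at s.  The bound 1 - c / 2
    keeps a margin that the next term, of modulus at most 5 / 8 c, may use up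
    only where the partial sum is close to its value at s. *)
Definition peak_stage (U : set K) (c : R) (S : C) :=
  [/\ ua_set X S, S s = rc k (1 - c), forall t, nrm (S t) <= 1 - c / 2 &
      forall t, ~ U t -> nrm (S t) <= (1 - c) / 4].

(** Add c / 2 times an approximate peak function that is small off the
    neighbourhood of s where the partial sum has modulus less than
    1 - c + c / 8. *)
Lemma peak_stage_next U c S : open U -> U s -> 0 < c -> c <= 1 ->
  peak_stage U c S -> exists2 S', peak_stage U (c / 2) S' &
    forall t, nrm (S' t - S t) <= c.
Proof.
move=> oU Us c0 c1 [XS Ss S1 SU].
pose V := [set t | nrm (S t) < 1 - c + c / 8].
have oV : open V.
  apply: (@open_comp _ _ (fun t => nrm (S t)) [set x | x < 1 - c + c / 8]).
    move=> t _; apply: continuous_comp; last exact: nrm_continuous.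
    exact: (@cts_fun K F S).
  exact: open_lt.
have Vs : V s by rewrite /V/= Ss nrm_rc ger0_norm; lra.
have [h [Xh hs h54 hUV]] := approx_peak (openI oU oV) (conj Us Vs).
have hc t : nrm (rc k (c / 2) * h t) = c / 2 * nrm (h t).
  by rewrite nrmM nrm_rc ger0_norm//; lra.
exists (S + rc k (c / 2) *: h); last first.
  move=> t; rewrite cfunDE cfunZE addrC addKr hc.
  by have := h54 t; nra.
split.
- by apply: ua_add => //; exact: ua_scale.
- by rewrite cfunDE cfunZE Ss hs mulr1 -rcD; congr rc; lra.
- move=> t; rewrite cfunDE cfunZE (le_trans (nrmD _ _))// hc.
  have [Vt|Vt] := pselect (V t).
    by have := h54 t; rewrite /V/= in Vt; nra.
  have : nrm (h t) <= 4^-1 by apply: hUV => -[].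
  by have := S1 t; nra.
- move=> t Ut; rewrite cfunDE cfunZE (le_trans (nrmD _ _))// hc.
  have : nrm (h t) <= 4^-1 by apply: hUV => -[].
  by have := SU t Ut; nra.
Qed.

(** Bishop's construction: halving the missing part at each stage gives a Cauchy
    sequence whose limit peaks exactly at s. *)
Lemma peak (U : set K) : open U -> U s -> exists h,
  [/\ ua_set X h, h s = 1, forall t, nrm (h t) <= 1 &
      forall t, ~ U t -> nrm (h t) <= 4^-1].
Proof.
move=> oU Us; pose c n : R := 2^-1 ^+ n.
have c0 n : 0 < c n by rewrite exprn_gt0// invr_gt0.
have c1 n : c n <= 1.
  by rewrite exprn_ile1// ?invr_ge0// invf_le1// ler1n.
have cS n : c n.+1 = c n / 2 by rewrite /c exprSr.
have /choice[nx nxP] (p : C * nat) : exists S', peak_stage U (c p.2) p.1 ->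
    peak_stage U (c p.2.+1) S' /\ forall t, nrm (S' t - p.1 t) <= c p.2.
  have [st|nst] := pselect (peak_stage U (c p.2) p.1); last by exists 0.
  have [S' sS' S'S] := peak_stage_next oU Us (c0 _) (c1 _) st.
  by exists S'; rewrite cS.
pose S := fix S n : C := if n is m.+1 then nx (S m, m) else 0.
have st n : peak_stage U (c n) (S n).
  elim: n => [|n /(nxP (S n, n))[]//]; split=> /=.
  - by have [z Xz zE] := ua_cstP X 0; rewrite -(scale0r z); exact: ua_scale.
  - by rewrite /c expr0 subrr rc0.
  - by move=> t; rewrite [leLHS](_ : _ = 0) ?nrm0// /c expr0; lra.
  - by move=> t _; rewrite [leLHS](_ : _ = 0) ?nrm0// /c expr0; lra.
have SS n t : nrm (S n.+1 t - S n t) <= c n.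
  by have [_] := nxP (S n, n) (st n); exact.
have Scauchy n d t : nrm (S (n + d)%N t - S n t) <= 2 * c n - 2 * c (n + d)%N.
  elim: d => [|d IH]; first by rewrite addn0 !subrr nrm0.
  rewrite addnS.
  have -> : S (n + d).+1 t - S n t =
    (S (n + d).+1 t - S (n + d)%N t) + (S (n + d)%N t - S n t).
    by rewrite addrA subrK.
  apply: le_trans (nrmD _ _) _; have := SS (n + d)%N t; rewrite cS; lra.
have [||||f Xf fS] := @ua_limit S (fun n => 2 * c n).
- by move=> n; case: (st n).
- by move=> n; rewrite mulr_ge0// ltW.
- move=> e e0; have [|n ne] := @half_pow_le R (e / 2); first by rewrite divr_gt0.
  by exists n; rewrite /c; lra.
- move=> n m t nm; have := Scauchy n (m - n)%N t; rewrite subnKC//.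
  by have := c0 m; lra.
have fle t B : (forall n, nrm (S n t) <= B) -> nrm (f t) <= B.
  move=> SB; apply: (@le_half_pow _ _ _ 4) => n.
  rewrite -[f t](subrK (S n t)); apply: le_trans (nrmD _ _) _.
  by have := fS n t; have := SB n; rewrite /c; lra.
exists f; split=> //.
- apply/eqP; rewrite -subr_eq0 -nrm_eq0; apply/eqP/le_anti/andP.
  split; last exact: nrm_ge0.
  apply: (@le_half_pow _ _ _ 5) => n.
  rewrite -[f s](subrK (S n s)) -addrA; apply: le_trans (nrmD _ _) _.
  have [_ Ss _ _] := st n; have := fS n s; rewrite Ss => fSs.
  rewrite -(rc1 R k) -rcB nrm_rc addrAC subrr sub0r normrN gtr0_norm//.
  by move: fSs; rewrite /c; lra.
- move=> t; apply: fle => n; have [_ _ /(_ t) + _] := st n.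
  by have := c0 n; lra.
- move=> t Ut; apply: fle => n; have [_ _ _ /(_ t Ut)] := st n.
  by have := c0 n; lra.
Qed.

End peaks.

(** * Disjoint neighbourhoods, and perturbations by peak functions *)

Section disjoint_neighbourhoods.
Variable K : compactHausdorffType.

(** Otherwise each point has a neighbourhood meeting A in at most that point, and
    compactness, through the filter of the large finite sets, makes A finite. *)
Lemma infinite_limit_point (A : set K) : infinite_set A -> limit_point A !=set0.
Proof.
move=> infA; apply: contrapT => nA; apply: infA.
pose B (D : set K) := [set D' : set K | finite_set D' /\ D `<=` D'].
have FF : Filter (filter_from (@finite_set K) B).
  apply: filter_from_filter; first by exists set0; exact: finite_set0.
  move=> D E fD fE; exists (D `|` E); first by rewrite finite_setU.
  by move=> D' [fD' DED']; split; split=> // x xD; apply: DED'; [left|right].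
have /compact_near_coveringP := @compact_setT K.
move=> /(_ _ _ (fun D x => A x -> D x) FF)[].
  move=> x _; have : ~ limit_point A x by move=> lx; apply: nA; exists x.
  rewrite not_limit_pointE => -[V Vx AV].
  exists (V, B [set x]).
    by split=> //; exists [set x] => //; exact: finite_set1.
  by move=> [u D] /= [Vu [_ xD]] Au; apply: xD; exact: AV.
move=> D fD /(_ D) AD; apply: (sub_finite_set _ fD) => x Ax.
by apply: AD => //; split.
Qed.

(** Points of A are chosen in shrinking neighbourhoods V_n of p: each new point is
    separated from p inside V_n, and V_(n+1) is its neighbourhood of p. *)
Lemma limit_point_disjoint_open (A : set K) (p : K) : limit_point A p ->
  exists (s : nat -> K) (U : nat -> set K),
    [/\ forall n, A (s n), forall n, open (U n), forall n, U n (s n) &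
        forall m n, (m < n)%N -> U m `&` U n = set0].
Proof.
move=> Ap.
have /choice[nx nxP] (V : set K) : exists c : K * set K * set K,
    open V /\ V p -> [/\ A c.1.1, open c.1.2 /\ c.1.2 c.1.1,
      open c.2 /\ c.2 p, c.1.2 `<=` V /\ c.2 `<=` V & c.1.2 `&` c.2 = set0].
  have [[oV Vp]|nV] := pselect (open V /\ V p); last by exists (p, V, V).
  have [a [ap Aa Va]] := Ap V (open_nbhs_nbhs (conj oV Vp)).
  have := @hausdorff K; rewrite open_hausdorff => /(_ a p ap).
  move=> [[P Q] /= [aP pQ] [oP oQ /eqP PQ0]].
  exists (a, P `&` V, Q `&` V) => _ /=; split.
  - exact: Aa.
  - by split; [exact: openI|split=> //; exact: set_mem].
  - by split; [exact: openI|split=> //; exact: set_mem].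
  - by split; exact: subIsetr.
  - by rewrite setIACA PQ0 set0I.
pose V := fix V n : set K := if n is m.+1 then (nx (V m)).2 else setT.
have oV n : open (V n) /\ V n p.
  elim: n => [|n /nxP[]//]; split=> //; exact: openT.
exists (fun n => (nx (V n)).1.1), (fun n => (nx (V n)).1.2); split.
- by move=> n; case: (nxP _ (oV n)).
- by move=> n; case: (nxP _ (oV n)) => _ [].
- by move=> n; case: (nxP _ (oV n)) => _ [].
- have VV m d : V (m + d)%N `<=` V m.
    elim: d => [|d IH]; first by rewrite addn0.
    rewrite addnS; apply: subset_trans IH => /=.
    by case: (nxP _ (oV (m + d)%N)) => _ _ _ [].
  move=> m n mn; rewrite -subset0 => x [Umx Unx].
  have [_ _ _ _ <-] := nxP _ (oV m); split=> //.
  apply: (VV m.+1 (n - m.+1)%N); rewrite subnKC//.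
  by case: (nxP _ (oV n)) => _ _ _ [UV _] _; exact: UV.
Qed.

End disjoint_neighbourhoods.

(** Real form of |w a + b (1 - w)| <= |a + b (1 - w)| for a = 2 (1 - h) and
    b = d (1 + h).  The difference of the squares is
    4 |1 - h|^2 (1 - |w|^2) + 4 d (1 - |h|^2) |1 - w|^2. *)
Lemma cayley_ineq (R : realType) (w1 w2 h1 h2 d A1 A2 B1 B2 : R) : 0 <= d ->
  w1 ^+ 2 + w2 ^+ 2 <= 1 -> h1 ^+ 2 + h2 ^+ 2 <= 1 ->
  A1 = 2 * (1 - h1) -> A2 = - 2 * h2 ->
  B1 = d * ((1 + h1) * (1 - w1) + h2 * w2) ->
  B2 = d * (h2 * (1 - w1) - (1 + h1) * w2) ->
  (w1 * A1 - w2 * A2 + B1) ^+ 2 + (w1 * A2 + w2 * A1 + B2) ^+ 2 <=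
  (A1 + B1) ^+ 2 + (A2 + B2) ^+ 2.
Proof.
move=> d0 w1w h1h -> -> -> ->; rewrite -subr_ge0.
rewrite [X in 0 <= X](_ : _ =
  4 * ((1 - h1) ^+ 2 + h2 ^+ 2) * (1 - (w1 ^+ 2 + w2 ^+ 2)) +
  4 * d * (1 - (h1 ^+ 2 + h2 ^+ 2)) * ((1 - w1) ^+ 2 + w2 ^+ 2)); last by ring.
have sq x y : 0 <= x ^+ 2 + y ^+ 2 :> R by rewrite addr_ge0 ?sqr_ge0.
by rewrite addr_ge0// mulr_ge0 ?mulr_ge0 ?sq ?subr_ge0.
Qed.

Lemma cayley_den (L : fieldType) (x y z q : L) :
  x * (1 - z) + y * (1 + z) * (1 - q) =
  x + y - ((x - y) * z + y * ((1 + z) * q)).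
Proof. by ring. Qed.

Lemma cayley_diff (L : fieldType) (w a b : L) : a + b * (1 - w) != 0 ->
  (w * a + b * (1 - w)) / (a + b * (1 - w)) - w =
  b * (1 - w) * (1 - w) / (a + b * (1 - w)).
Proof. by move=> d0; field. Qed.

Section perturbation.
Variables (R : realType) (k : scalar_kind) (K : compactHausdorffType).
Variable X : uniform_algebra K R k.
Local Notation F := (scalars R k).
Local Notation C := (cfun K R k).

(** For w = (1 - e/2) v and a peak function h, set a = 2 (1 - h) and
    b = d (1 + h).  The quotient y = (w a + b (1 - w)) / (a + b (1 - w)) is the
    inverse Cayley transform of (1 + w) / (1 - w) + d (1 + h) / (1 - h), cleared
    of denominators.  It is 1 where h = 1, and y - w is of order d where h is
    small.  Shrinking v to w keeps the real part of the denominator away from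
    0. *)
Lemma peak_perturbation (v : C) (s : K) (U : set K) (e : R) :
  choquet_boundary X s -> open U -> U s -> 0 < e -> e <= 1 ->
  ua_set X v -> (forall t, nrm (v t) <= 1) -> exists y,
  [/\ ua_set X y, y s = 1, forall t, nrm (y t) <= 1 &
      forall t, ~ U t -> nrm (y t - v t) <= e].
Proof.
move=> cs oU Us e0 e1 Xv v1.
have [h [Xh hs h1 hU]] := peak cs oU Us.
have [u Xu uE] := ua_cstP X 1.
pose d := e / 10.
have [w Xw wE] : exists2 w, ua_set X w & forall t, w t = rc k (1 - e / 2) * v t.
  by exists (rc k (1 - e / 2) *: v) => //; exact: ua_scale.
have w1 t : nrm (w t) <= 1 - e / 2.
  by rewrite wE nrmM nrm_rc ger0_norm; [have := v1 t; nra|lra].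
have [a Xa aE] : exists2 a, ua_set X a & forall t, a t = rc k 2 * (1 - h t).
  exists (rc k 2 *: (u - h)); first by apply: ua_scale; exact: ua_sub.
  by move=> t; rewrite cfunZE cfunBE uE.
have [b Xb bE] : exists2 b, ua_set X b & forall t, b t = rc k d * (1 + h t).
  exists (rc k d *: (u + h)); first by apply: ua_scale; exact: ua_add.
  by move=> t; rewrite cfunZE cfunDE uE.
have Xbw : ua_set X (b * (u - w)) by apply: ua_mul => //; exact: ua_sub.
have [num Xn nE] : exists2 num, ua_set X num &
    forall t, num t = w t * a t + b t * (1 - w t).
  exists (w * a + b * (u - w)); first by apply: ua_add => //; exact: ua_mul.
  by move=> t; rewrite cfunDE !cfunME cfunBE uE.
have [den Xd dE] : exists2 den, ua_set X den &
    forall t, den t = a t + b t * (1 - w t).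
  exists (a + b * (u - w)); first exact: ua_add.
  by move=> t; rewrite cfunDE cfunME cfunBE uE.
have d0 : 0 < d by rewrite divr_gt0.
have d2 : 0 <= 2 - d by rewrite /d; lra.
(* the denominator is 2 + d minus a term of modulus at most
   2 - d + 2 d (1 - e/2) *)
have den_ge t : d * e <= re (den t).
  pose z := rc k (2 - d) * h t + rc k d * ((1 + h t) * w t).
  have -> : den t = rc k (2 + d) - z.
    rewrite dE aE bE (rcD k 2 d) /z (rcB k 2 d).
    exact: cayley_den.
  have zle : nrm z <= (2 - d) + d * (2 * (1 - e / 2)).
    apply: le_trans (nrmD _ _) _; rewrite !nrmM !nrm_rc !ger0_norm ?(ltW d0)//.
    apply: lerD; first by rewrite ler_piMr.
    rewrite ler_pM2l//; apply: ler_pM => //; rewrite ?nrm_ge0//.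
    by apply: le_trans (nrmD _ _) _; rewrite nrm1; have := h1 t; lra.
  rewrite reB re_rc; apply: (@le_trans _ _ (2 + d - nrm z)).
    by move: zle; rewrite /d; nra.
  by rewrite lerB// (le_trans (ler_norm _))// re_le_nrm.
have [|q Xq qE] := ua_inv _ Xd den_ge; first by rewrite mulr_gt0.
have den0 t : 0 < nrm (den t).
  have := le_trans (ler_norm (re (den t))) (re_le_nrm _); have := den_ge t.
  have : 0 < d * e by rewrite mulr_gt0.
  by lra.
have denN t : den t != 0 by rewrite -nrm_gt0.
have yE t : cfun_val (num * q) t = num t / den t by rewrite -qE.
exists (num * q); split; first exact: ua_mul.
- have ns : num s = den s by rewrite nE dE aE hs subrr !mulr0.
  by rewrite yE ns mulfV.
- move=> t; rewrite yE nrmM nrmV ler_pdivrMr// mul1r.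
  rewrite -(@ler_pXn2r _ 2)// ?nnegrE ?nrm_ge0// !nrm_sqr nE dE aE bE.
  rewrite !(reD, imD, reM, imM, reN, imN, re1, im1, re_rc, im_rc).
  have := @cayley_ineq R (re (w t)) (im (w t)) (re (h t)) (im (h t)) d _ _ _ _ (ltW d0).
  rewrite -!nrm_sqr !expr_le1 ?nrm_ge0// => H.
  have w1' : nrm (w t) <= 1 by have := w1 t; lra.
  have := H _ _ _ _ w1' (h1 t) erefl erefl erefl erefl.
  by move=> {}H; apply: (le_trans _ (le_trans H _));
    rewrite le_eqVlt; apply/orP; left; apply/eqP; ring.
- move=> t Ut; have ht := hU t Ut.
  rewrite -[num * q]/(num * q : C) yE.
  have wv : nrm (w t - v t) <= e / 2.
    have -> : w t - v t = rc k (- (e / 2)) * v t.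
      by rewrite wE rcB rc1 mulrBl mul1r addrAC subrr sub0r rcN mulNr.
    by rewrite nrmM nrm_rc normrN gtr0_norm ?divr_gt0//; have := v1 t; nra.
  rewrite -(subrK (w t) (num t / den t)) -addrA.
  apply: le_trans (nrmD _ _) _.
  rewrite nE dE cayley_diff -?dE//.
  have n1w : nrm (1 - w t) <= 2.
    by apply: le_trans (nrmB _ _) _; rewrite nrm1; have := w1 t; lra.
  have nb : nrm (b t) <= d * (5 / 4).
    rewrite bE nrmM nrm_rc gtr0_norm// ler_pM2l//.
    by apply: le_trans (nrmD _ _) _; rewrite nrm1; lra.
  have nd : 1 <= nrm (den t).
    have na : 3 / 2 <= nrm (a t).
      rewrite aE nrmM nrm_rc ger0_norm//.
      have := nrmD (1 - h t) (h t); rewrite subrK nrm1; lra.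
    have := nrmB (den t) (b t * (1 - w t)); rewrite dE addrK nrmM.
    have := nrm_ge0 (b t); have := nrm_ge0 (1 - w t); rewrite /d in nb *; nra.
  have : nrm (b t * (1 - w t) * (1 - w t) / den t) <= e / 2.
    rewrite !nrmM nrmV ler_pdivrMr//.
    have bw : nrm (b t) * nrm (1 - w t) * nrm (1 - w t) <= d * (5 / 4) * 2 * 2.
      by rewrite !ler_pM ?mulr_ge0 ?nrm_ge0.
    by apply: (le_trans bw); rewrite /d; nra.
  by lra.
Qed.

End perturbation.

(** * Weak convergence and the conclusion *)

Section weak_convergence.
Variables (F : numFieldType) (E : normedModType F).

(** Convergence for a supremum of topologies is convergence for each of them, so
    weakly convergent sequences are controlled one functional at a time. *)
Lemma cvg_weak_eventually (y : nat -> E) (v : E) (U : set (weak_topology E)) :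
  open U -> U v ->
  (forall phi, topological_dual phi -> phi (y n) @[n --> \oo] --> phi v) ->
  \forall n \near \oo, U (y n).
Proof.
move=> oU Uv yv.
have cy : (y @ \oo : set_system (weak_topology E)) --> (v : weak_topology E).
  apply/cvg_sup => -[phi dphi] A /= [_ [[B Bop <-] Bv BA]].
  have [N _ yB] := yv _ dphi B (open_nbhs_nbhs (conj Bop Bv)).
  by exists N => // n Nn; exact: BA (yB n Nn).
by have := cy U (open_nbhs_nbhs (conj oU Uv)).
Qed.

End weak_convergence.

Section weak_approximation.
Variables (R : realType) (k : scalar_kind) (K : compactHausdorffType).
Variable X : uniform_algebra K R k.
Local Notation F := (scalars R k).
Local Notation E := (ua_type X).

Lemma ua_type_norm_le (f : E) (B : R) : 0 <= B ->
  (forall t, nrm (f t) <= B) -> `|f| <= rc k B.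
Proof.
move=> B0 fB; apply: cfun_norm_le; first by rewrite -(rc0 R k) ler_rc.
by move=> t; rewrite normE ler_rc.
Qed.

Lemma ua_type_norm1 (f : E) : `|f| <= 1 <-> forall t, nrm (f t) <= 1.
Proof.
split=> [f1 t|f1]; last by rewrite -(rc1 R k); exact: ua_type_norm_le.
by rewrite -(ler_rc k) rc1 -normE (le_trans _ f1)//; exact: cfun_norm_ge.
Qed.

Lemma dual_bounded (phi : E -> F) : topological_dual phi ->
  exists M : R, 0 <= M /\ forall (f : E) (B : R), 0 <= B ->
    (forall t, nrm (f t) <= B) -> nrm (phi f) <= M * B.
Proof.
move=> [lphi cphi].
pose phiL : {linear E -> F^o} := HB.pack phi (GRing.isLinear.Build _ _ _ _ phi lphi).
have /linear_boundedP/pinfty_ex_gt0[r r0 rphi] : bounded_near phiL (nbhs (0 : E)).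
  by apply/linear_bounded_continuous; exact: cphi.
have rE := ge0_rc (ltW r0).
exists (re r); split; first by rewrite -(ler_rc k) -rE rc0 ltW.
move=> f B B0 fB; rewrite -(ler_rc k) rcM -rE -normE.
by apply: le_trans (rphi f) _; rewrite ler_pM2l//; exact: ua_type_norm_le.
Qed.

(** Choosing rotations l_i with l_i phi(z_i) = |phi(z_i)|, the partial sums of
    |phi(z_i)| are the values of phi at the sums of l_i z_i, which stay bounded;
    so their series converges and its terms tend to 0. *)
Lemma dual_cvg0 (z : nat -> E) (M : R) (phi : E -> F) :
  0 <= M -> (forall n t, \sum_(0 <= i < n) nrm (z i t) <= M) ->
  topological_dual phi -> phi (z n) @[n --> \oo] --> (0 : F).
Proof.
move=> M0 zM dphi; have [B [B0 phiB]] := dual_bounded dphi.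
have phiD f g : phi (f + g) = phi f + phi g.
  by have := dphi.1 1 f g; rewrite !scale1r.
have phi0 : phi 0 = 0.
  by have := dphi.1 (-1) 0 0; rewrite scaler0 addr0 scaleN1r addNr.
have phiZ a f : phi (a *: f) = a * phi f.
  by have := dphi.1 a f 0; rewrite !addr0 phi0 addr0.
have /choice[l lP] n : exists l : F,
    nrm l = 1 /\ l * phi (z n) = rc k (nrm (phi (z n))).
  by have [l l1 lz] := nrm_rot (phi (z n)); exists l.
pose g n : E := \sum_(0 <= i < n) l i *: z i.
have gle n t : nrm (g n t) <= \sum_(0 <= i < n) nrm (z i t).
  elim: n => [|n IH]; first by rewrite /g !big_nil [leLHS](_ : _ = 0) ?nrm0.
  rewrite /g !big_nat_recr//= -/(g n).
  rewrite [leLHS](_ : _ = nrm (g n t + l n * z n t))//.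
  apply: le_trans (nrmD _ _) _; rewrite lerD// nrmM.
  by case: (lP n) => -> _; rewrite mul1r.
have phig n : phi (g n) = rc k (\sum_(0 <= i < n) nrm (phi (z i))).
  elim: n => [|n IH]; first by rewrite /g !big_nil phi0 rc0.
  rewrite /g !big_nat_recr//= -/(g n) phiD phiZ rcD IH.
  by case: (lP n) => _ ->.
pose a n := nrm (phi (z n)).
have aM n : \sum_(0 <= i < n) a i <= B * M.
  rewrite -[leLHS]ger0_norm ?sumr_ge0// => [|i _]; last exact: nrm_ge0.
  rewrite -(nrm_rc k) -phig; apply: phiB => // t.
  by apply: le_trans (gle n t) (zM n t).
have : a @ \oo --> 0.
  apply: cvg_series_cvg_0; apply: nondecreasing_is_cvgn.
    by apply: nondecreasing_series => n _ _; exact: nrm_ge0.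
  by exists (B * M) => _ [n _ <-]; exact: aM.
move=> /cvgrPdist_lt a0; apply/cvgrPdist_lt => e e0.
have eE := ge0_rc (ltW e0).
have re0 : 0 < re e by rewrite -(ltr_rc k) -eE rc0.
have [N _ aN] := a0 _ re0; exists N => // n Nn.
have := aN n Nn; rewrite /= !sub0r !normrN ger0_norm ?nrm_ge0// => an.
by rewrite normE eE ltr_rc.
Qed.

Lemma dualB (phi : E -> F) f g : topological_dual phi ->
  phi (f - g) = phi f - phi g.
Proof.
by move=> [lphi _]; have := lphi (-1) g f; rewrite !scaleN1r ![- _ + _]addrC.
Qed.

(** As the sets are disjoint, at most one of the terms exceeds 2^-i, and that one
    is at most 2. *)
Lemma bump_sum_le (U : nat -> set K) (a : nat -> R) (t : K) :
  (forall m n, (m < n)%N -> U m `&` U n = set0) -> (forall n, a n <= 2) ->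
  (forall n, ~ U n t -> a n <= 2^-1 ^+ n) ->
  forall n, \sum_(0 <= i < n) a i <= 4.
Proof.
move=> UU a2 aU n; pose b n := `[< exists2 m, (m < n)%N & U m t >].
suff : \sum_(0 <= i < n) a i <= 2 - 2 * 2^-1 ^+ n + 2 * (b n)%:R.
  move/le_trans; apply; have : 0 <= 2^-1 ^+ n :> R by rewrite exprn_ge0// invr_ge0.
  by case: (b n) => /=; lra.
elim: n => [|n IH].
  by rewrite big_nil expr0 mulr1 subrr add0r mulr_ge0.
rewrite big_nat_recr//= exprSr.
have p0 : 0 <= 2^-1 ^+ n :> R by rewrite exprn_ge0// invr_ge0.
have bS : b n -> b n.+1.
  by move=> /asboolP[m mn Um]; apply/asboolP; exists m => //; exact: ltnW.
have [Ut|/aU an] := pselect (U n t); last first.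
  by move: IH; case: (b n) bS => [->//|_] /=; [lra|case: (b n.+1) => /=; lra].
have -> : b n.+1 by apply/asboolP; exists n.
suff bn : ~~ b n by move: IH; rewrite (negbTE bn)/=; have := a2 n; lra.
apply/asboolP => -[m mn Um]; have : (U m `&` U n) t by [].
by rewrite UU.
Qed.

(** Perturb v near each s_n with error 2^-n off U_n: the disjointness of the U_n
    bounds the sums of |y_n - v| on K, whence weak convergence. *)
Lemma weak_approx_peaking (v : E) (s : nat -> K) (U : nat -> set K) :
  `|v| <= 1 -> (forall n, choquet_boundary X (s n)) ->
  (forall n, open (U n)) -> (forall n, U n (s n)) ->
  (forall m n, (m < n)%N -> U m `&` U n = set0) ->
  exists y : nat -> E, [/\ forall n, `|y n| <= 1, forall n, y n (s n) = 1 &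
    forall phi, topological_dual phi -> phi (y n) @[n --> \oo] --> phi v].
Proof.
move=> /ua_type_norm1 v1 cs oU Us UU.
have Xv : ua_set X v by case: v {v1} => f /= /set_mem.
have /choice[y yP] n : exists y : E, [/\ y (s n) = 1, forall t, nrm (y t) <= 1 &
    forall t, ~ U n t -> nrm (y t - v t) <= 2^-1 ^+ n].
  have [||y [Xy ys y1 yU]] :=
      @peak_perturbation _ _ _ _ _ _ _ (2^-1 ^+ n) (cs n) (oU n) (Us n) _ _ Xv v1.
  - by rewrite exprn_gt0// invr_gt0.
  - by rewrite exprn_ile1// ?invr_ge0// invf_le1// ler1n.
  by exists (UAType (mem_set Xy)).
exists y; split=> [n|n|phi dphi]; [|by case: (yP n)|].
  by apply/ua_type_norm1; case: (yP n).
have : phi (y n - v) @[n --> \oo] --> (0 : F).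
  apply: (@dual_cvg0 (fun n => y n - v) 4) => // n t.
  apply: (@bump_sum_le U) => // m; last by case: (yP m) => _ _; exact.
  apply: le_trans (nrmB (y m t) (v t)) _.
  by case: (yP m) => _ /(_ t) + _; have := v1 t; lra.
move=> /cvgrPdist_lt c0; apply/cvgrPdist_lt => e e0.
have [N _ cN] := c0 _ e0; exists N => // n Nn.
by have := cN n Nn; rewrite /= dualB// sub0r normrN distrC.
Qed.

(** Near s0 the function x is almost 1, and infinitely many boundary points lie
    there.  Functions taking the value 1 at some of them converge weakly to -x;
    their opposites enter V, while they are at distance almost 2 from x. *)
Lemma derived_point_DD2P (x : E) (s0 : K) (V : set E) : `|x| <= 1 ->
  derived_set (choquet_boundary X) s0 -> x s0 = 1 ->
  relatively_weakly_open V -> V x -> supremums [set `|x - y| | y in V] 2%:R.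
Proof.
move=> x1 [_ s0lim] xs [O oO ->] [_ Ox].
split=> [_ [z [z1 _] <-]|w xw].
  by rewrite (le_trans (ler_normB _ _))// -[2%:R]/(1 + 1) lerD.
apply/ler_addgt0Pr => e e0; have eE := ge0_rc (ltW e0).
have re0 : 0 < re e by rewrite -(ltr_rc k) -eE rc0.
pose N1 := [set t | nrm (x t - 1) < re e].
have oN1 : open N1.
  apply: (@open_comp _ _ (fun t => nrm (x t - 1)) [set r | r < re e]).
    move=> t _.
    apply: (@continuous_comp _ _ _ (fun t => x t - 1) (@nrm R k));
      last exact: nrm_continuous.
    by apply: cvgB; [exact: (@cts_fun K F x)|exact: cvg_cst].
  exact: open_lt.
have N1s0 : N1 s0 by rewrite /N1/= xs subrr nrm0.
have : limit_point (choquet_boundary X `&` N1) s0.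
  move=> A As0; have [t [ts ct [At Vt]]] :=
    s0lim _ (filterI As0 (open_nbhs_nbhs (conj oN1 N1s0))).
  by exists t.
move=> /limit_point_disjoint_open[s' [U' [sN oU' Us' UU']]].
have [||y' [y'1 y's y'x]] := @weak_approx_peaking (- x) s' U' _ _ oU' Us' UU'.
- by rewrite normrN.
- by move=> n; case: (sN n).
have Ny'x phi : topological_dual phi -> phi (- y' n) @[n --> \oo] --> phi x.
  move=> dphi; have phiN f : phi (- f) = - phi f.
    have phi00 : phi 0 = 0 by rewrite -(subrr 0) dualB// subrr.
    by rewrite -sub0r dualB// phi00 sub0r.
  under eq_fun do rewrite phiN.
  by rewrite -[phi x]opprK -phiN; apply: cvgN; exact: y'x.
have [N' _ /(_ N' (leqnn N')) ON] := cvg_weak_eventually oO Ox Ny'x.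
apply: le_trans (lerD (xw `|x + y' N'| _) (lexx e)); last first.
  exists (- y' N'); last by rewrite opprK.
  by split=> //; rewrite /unit_ball/= normrN.
have [_ Ns'] := sN N'.
rewrite -lerBlDr; apply: (@le_trans _ _ `|(x + y' N') (s' N')|);
  last exact: cfun_norm_ge.
have -> : (x + y' N') (s' N') = x (s' N') + 1 by rewrite -(y's N').
rewrite eE normE -(rc_nat R k) -rcB ler_rc.
have := nrmB (x (s' N') + 1) (x (s' N') - 1).
have -> : x (s' N') + 1 - (x (s' N') - 1) = rc k 2.
  by rewrite opprB [1 - _]addrC addrACA subrr add0r -(rc1 R k) -rcD.
by rewrite nrm_rc ger0_norm//; move: Ns'; rewrite /N1/=; lra.
Qed.

End weak_approximation.

Theorem corollary2p10 (R : realType) (k : scalar_kind)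
    (K : compactHausdorffType) (X : uniform_algebra K R k) :
  infinite_set (derived_set (choquet_boundary X)) ->
  weak_DD2P (ua_type X).
Proof.
move=> /infinite_limit_point[p].
move=> /limit_point_disjoint_open[s [U [sD oU Us UU]]].
move=> W [O oO ->] [v [v1 Ov]].
have [|y [y1 ys yv]] := weak_approx_peaking v1 _ oU Us UU.
  by move=> n; case: (sD n).
have [N _ /(_ N (leqnn N)) ON] := cvg_weak_eventually oO Ov yv.
exists (y N); first by split=> //; exact: y1.
by move=> V oV Vy; exact: (derived_point_DD2P (y1 N) (sD N) (ys N) oV Vy).
Qed.
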